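(* Let $K$ be a field and $c\ge 1$ an integer. Let $\mathbf{M}$ be a finitely generated graded $\mathrm{OI}$-module over $(\mathbf{X}^{\mathrm{OI},1})^{\otimes c}$ or a finitely generated graded $\mathrm{FI}$-module over $(\mathbf{X}^{\mathrm{FI},1})^{\otimes c}$, with $\mathbf{M}_n \neq 0$ for all sufficiently large $n$. Then there are integers $A, B, M, L$ with $0 \le A \le c$, $M > 0$, and $L \ge 0$ such that, for all sufficiently large $n$, \[ \dim \mathbf{M}_n = A n + B \] and the limit of $\frac{\deg \mathbf{M}_n}{M^{n } \cdot n^{L}}$ as $n \to \infty$ exists and is equal to a positive rational number. In particular, the limits \[ \lim_{n \to \infty} \frac{\dim \mathbf{M}_n}{n} = A \quad \text{ and } \quad \lim_{n \to \infty} \sqrt[n]{\deg \mathbf{M}_n} = M \] are non-negative integers.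
   Context: $\mathrm{OI}$ (resp. $\mathrm{FI}$) is the category with objects $[n] = \{1,\dots,n\}$, $n \ge 0$ ($[0]=\emptyset$), and morphisms the strictly increasing (resp. injective) maps $\varepsilon\colon [m]\to[n]$. The $\mathrm{OI}$-algebra $(\mathbf{X}^{\mathrm{OI},1})^{\otimes c}$ (resp. $\mathrm{FI}$-algebra $(\mathbf{X}^{\mathrm{FI},1})^{\otimes c}$) over $K$ is the functor $\mathbf{P}$ from $\mathrm{OI}$ (resp. $\mathrm{FI}$) to commutative $K$-algebras with $\mathbf{P}_n = K[x_{i,j} : 1\le i\le c,\ 1\le j\le n]$ (so $\mathbf{P}_0=K$) and, for $\varepsilon\colon[m]\to[n]$, $\varepsilon_*\colon \mathbf{P}_m\to\mathbf{P}_n$ the $K$-algebra homomorphism with $\varepsilon_*(x_{i,j}) = x_{i,\varepsilon(j)}$. Every variable has degree one. An $\mathrm{OI}$-module (resp. $\mathrm{FI}$-module) $\mathbf{M}$ over $\mathbf{P}$ is a functor from $\mathrm{OI}$ (resp. $\mathrm{FI}$) to $K$-vector spaces such that each $\mathbf{M}_n = \mathbf{M}([n])$ is a $\mathbf{P}_n$-module and $\mathbf{M}(\varepsilon)(aq) = \varepsilon_*(a)\,\mathbf{M}(\varepsilon)(q)$ for all $\varepsilon\colon[m]\to[n]$, $a\in\mathbf{P}_m$, $q\in\mathbf{M}_m$. It is graded if every $\mathbf{M}_n$ is a $\mathbb{Z}$-graded $\mathbf{P}_n$-module and every $\mathbf{M}(\varepsilon)$ is homogeneous of degree $0$. It is finitely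 generated if there is a finite subset of $\coprod_n \mathbf{M}_n$ not contained in any proper submodule (subfunctor compatible with the module structures). For a nonzero finitely generated graded module $N$ over a standard graded polynomial ring in finitely many variables over $K$, the Hilbert series can be written uniquely as $\sum_{j}\dim_K[N]_j t^j = \frac{g_N(t)}{(1-t)^D}$ with $g_N(t)\in\mathbb{Z}[t,t^{-1}]$ and $g_N(1)\neq 0$; then $\dim N = D$ is the Krull dimension of $N$ and $\deg N = g_N(1) > 0$ is its degree (multiplicity). *)

(* Defs.v *)
From HB Require Import structures.
From mathcomp Require Import all_boot all_order all_algebra.
From mathcomp Require Import all_classical all_reals all_analysis.
(* The notations of mpoly clash with those of mathcomp-analysis. *)
From mathcomp Require Import -(notations) mpoly.

Set Implicit Arguments.
Unset Strict Implicit.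
Unset Printing Implicit Defensive.

Import GRing.Theory.
Local Open Scope ring_scope.

(** * The categories OI and FI; the object [n] is the finite type 'I_n *)

Inductive indexcat := OI | FI.

Definition is_mor (C : indexcat) m n (e : {ffun 'I_m -> 'I_n}) : bool :=
  match C with
  | OI => [forall i : 'I_m, forall j : 'I_m, (i < j)%N ==> (e i < e j)%N]
  | FI => injectiveb e
  end.

Definition mor C m n := {e : {ffun 'I_m -> 'I_n} | is_mor C e}.

Definition mor_fun C m n (e : mor C m n) : 'I_m -> 'I_n := val e.
Coercion mor_fun : mor >-> Funclass.

Lemma is_mor_id C n : is_mor C [ffun i : 'I_n => i].
Proof.
case: C => /=; last by apply/injectiveP => i j; rewrite !ffunE.
by apply/forallP => i; apply/forallP => j; rewrite !ffunE; apply/implyP.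
Qed.

Lemma is_mor_comp C m n p (f : mor C n p) (e : mor C m n) :
  is_mor C [ffun i => f (e i)].
Proof.
case: C f e => -[f fP] [e eP]; rewrite /mor_fun /=.
  apply/forallP => i; apply/forallP => j; apply/implyP => lt_ij; rewrite !ffunE.
  have /forallP/(_ i)/forallP/(_ j)/implyP/(_ lt_ij) lt_e := eP.
  by have /forallP/(_ (e i))/forallP/(_ (e j))/implyP/(_ lt_e) := fP.
apply/injectiveP => i j; rewrite !ffunE => /(injectiveP _ fP).
exact: (injectiveP _ eP).
Qed.

Definition mor_id C n : mor C n n := Sub [ffun i => i] (is_mor_id C n).

Definition mor_comp C m n p (f : mor C n p) (e : mor C m n) : mor C m p :=
  Sub [ffun i => f (e i)] (is_mor_comp f e).

(** * The algebra P, with P_n = K[x_(i,j) : i in 'I_c, j in 'I_n] *)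

(* The variables are numbered by [enum_rank]. *)
Definition nvars (c n : nat) := #|{: 'I_c * 'I_n}|.

Definition P (K : fieldType) (c n : nat) := mpoly (nvars c n) K.

Definition xvar (K : fieldType) c n (i : 'I_c) (j : 'I_n) : P K c n :=
  mpolyX K (mnm1 (enum_rank (i, j))).

Definition push (K : fieldType) c C m n (e : mor C m n) : P K c m -> P K c n :=
  mmap (@mpolyC (nvars c n) K)
       (fun k => xvar K (enum_val k).1 (e (enum_val k).2)).

Lemma push_const (K : fieldType) c C m n (e : mor C m n) (a : K) :
  push e (mpolyC (nvars c m) a) = mpolyC (nvars c n) a.
Proof. exact: mmapC. Qed.

Lemma push_xvar (K : fieldType) c C m n (e : mor C m n) (i : 'I_c) (j : 'I_m) :
  push e (xvar K i j) = xvar K i (e j).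
Proof. by rewrite /push /xvar mmapX mmap1U enum_rankK. Qed.

Lemma push_is_ring_morphism (K : fieldType) c C m n (e : mor C m n) :
  [/\ {morph @push K c C m n e : p q / p + q},
      {morph @push K c C m n e : p q / p * q} & push e (1 : P K c m) = 1].
Proof.
by split=> [p q|p q|]; rewrite /push ?(rmorphD, rmorphM, rmorph1).
Qed.

(** * Modules over P *)

(* The K-vector space structure of each M_n is the one induced by constant
   polynomials; the K-linearity of the structure maps is the case of constant
   [a] in [cmapZ]. *)
Record Cmodule (K : fieldType) (c : nat) (C : indexcat) := CModule {
  cobj :> forall n, lmodType (P K c n);
  cmap : forall m n, mor C m n -> cobj m -> cobj n;
  cmapD : forall m n (e : mor C m n) (u v : cobj m),
    cmap e (u + v) = cmap e u + cmap e v;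
  cmapZ : forall m n (e : mor C m n) (a : P K c m) (v : cobj m),
    cmap e (a *: v) = push e a *: cmap e v;
  cmap_id : forall n (v : cobj n), cmap (mor_id C n) v = v;
  cmap_comp : forall m n p (f : mor C n p) (e : mor C m n) (v : cobj m),
    cmap (mor_comp f e) v = cmap f (cmap e v)
}.

Record is_submodule K c C (M : Cmodule K c C) (S : forall n, set (M n)) : Prop :=
  IsSubmodule {
  submod0 : forall n, S n 0;
  submodD : forall n (u v : M n), S n u -> S n v -> S n (u + v);
  submodZ : forall n (a : P K c n) (v : M n), S n v -> S n (a *: v);
  submod_map : forall m n (e : mor C m n) (v : M m), S m v -> S n (cmap e v)
}.

Definition finitely_generated K c C (M : Cmodule K c C) : Prop :=
  exists (k : nat) (gen : 'I_k -> {n : nat & M n}),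
    forall S : (forall n, set (M n)), is_submodule S ->
      (forall i, S (projT1 (gen i)) (projT2 (gen i))) ->
      forall n (v : M n), S n v.

(** * Gradings *)

Record grading (K : fieldType) (r : nat) (N : lmodType (mpoly r K)) := Grading {
  hcomp :> int -> set N;
  hcomp0 : forall j, hcomp j 0;
  hcompB : forall j (u v : N), hcomp j u -> hcomp j v -> hcomp j (u - v);
  hcompZ : forall (d : nat) (j : int) (a : mpoly r K) (v : N),
    a \is ishomog1 d mdeg -> hcomp j v -> hcomp (d%:Z + j) (a *: v);
  hcomp_span : forall v : N, exists (s : seq int) (w : int -> N),
    (forall j, hcomp j (w j)) /\ v = \sum_(j <- s) w j;
  hcomp_indep : forall (s : seq int) (w : int -> N), uniq s ->
    (forall j, hcomp j (w j)) -> \sum_(j <- s) w j = 0 ->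
    forall j, j \in s -> w j = 0
}.

Record Cgrading K c C (M : Cmodule K c C) := CGrading {
  cgrading :> forall n, grading (M n);
  cmap_homog : forall m n (e : mor C m n) (j : int) (v : M m),
    cgrading m j v -> cgrading n j (cmap e v)
}.

(** * Hilbert series, dimension and degree *)

Definition has_Kdim (K : fieldType) (r : nat) (N : lmodType (mpoly r K))
    (V : set N) (d : nat) : Prop :=
  exists b : 'I_d -> N, (forall i, V (b i)) /\
    (forall v, V v -> exists! a : {ffun 'I_d -> K},
       v = \sum_i mpolyC r (a i) *: b i).

(* [xget x0 A] is an element of [A] if there is one, and [x0] otherwise; it is
   used below only on sets with at most one element. *)
Definition hilbert_fun (K : fieldType) (r : nat) (N : lmodType (mpoly r K))
    (G : grading N) (j : int) : nat :=
  xget 0%N [set d | has_Kdim (G j) d]%classic.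

(* With H the Laurent series of coefficients [h] and g(t) = t^(-s) p(t):
   H(t) = g(t) / (1 - t)^D and g(1) != 0. The identity is expressed as the
   equality t^s H(t) (1 - t)^D = p(t) of power series. *)
Definition hilbert_form (h : int -> nat) (D s : nat) (p : {poly int}) : Prop :=
  [/\ forall j : int, j < - s%:Z -> h j = 0%N,
      forall m : nat,
        \sum_(i < m.+1) ((1 - 'X) ^+ D : {poly int})`_i
                        * (h ((m - i)%N%:Z - s%:Z))%:Z = p`_m
    & p.[1] != 0].

(* dim N is the exponent D in H(t) = g(t) / (1 - t)^D with g(1) != 0. *)
Definition mdim (K : fieldType) (r : nat) (N : lmodType (mpoly r K))
    (G : grading N) : nat :=
  xget 0%N [set D | exists s p, hilbert_form (hilbert_fun G) D s p]%classic.

(* [p.[1]] is the value at 1 of the Laurent polynomial t^(-s) p(t). *)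
Definition mdegree (K : fieldType) (r : nat) (N : lmodType (mpoly r K))
    (G : grading N) : int :=
  xget 0 [set g1 | exists D s p,
                   hilbert_form (hilbert_fun G) D s p /\ g1 = p.[1]]%classic.

(* Main.v *)
Require Import Defs.
From HB Require Import structures.
From mathcomp Require Import all_boot all_order all_algebra.
From mathcomp Require Import all_classical all_reals all_analysis.
From mathcomp Require Import zify ring.
From mathcomp Require Import -(notations) mpoly.
Import numFieldNormedType.Exports.
Import GRing.Theory Num.Theory Order.TTheory.

Set Implicit Arguments.
Unset Strict Implicit.
Unset Printing Implicit Defensive.

Local Open Scope classical_set_scope.
Local Open Scope ring_scope.

(** An injection is a permutation followed by an increasing map, so an FI-module
    that is finitely generated remains so as an OI-module, and dimensions and
    degrees do not change. Let [M] be an OI-module, with homogeneous generators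
    [g_k] in [M d_k].

    Standard elements. [M n] is spanned over [K] by the vectors [x^a e_* g_k],
    where [e] is an increasing map from [d_k] to [n]. Order their indices
    [(k, e, a)] totally and compatibly with multiplication by monomials and with
    the structure maps, and call an index standard if its vector is not a linear
    combination of smaller ones of the same degree. The standard indices of
    degree [j] give a basis of the component of [M n] of degree [j]
    ([has_Kdim_std_count]), and the multiples of nonstandard indices are
    nonstandard ([nonstd_act]).

    Words. Write [(e, a)] as a word of length [n], whose letter at [j] consists of
    the exponents of the variables [x_(i, j)] and of a mark that tells whether
    [j] is in the image of [e]. Divisibility becomes the subword order of Higman
    ([word_le_enc]), which is a well quasi-order ([higman]). So for each [k]
    the Hilbert function of [M] counts the words with [d_k] marks in an order
    ideal.

    A recursion. Let [S] be an order ideal of words and [X n] the generating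
    series of the words of length [n] in [S] with [d] marks. For a letter [l],
    the words [w] with [l w] in [S] form an order ideal contained in [S], and the
    exponent vectors fall into finitely many boxes on which this ideal is
    constant ([letter_decomp]). Hence [X n.+1 = f * X n + Y n], where [f] is the
    series of the unmarked letters that lead back to [S], while [Y] comes from
    ideals that are strictly smaller or from fewer marks. As there is no infinite
    strictly decreasing chain of order ideals, induction applies
    ([linear_growth_words]).

    Poles at 1. The series of a box is [t^a / (1 - t)^k] with [k <= c]; therefore
    all series are zero or of the form [p(t) / (1 - t)^D] with [p(1) > 0], and
    sums never cancel: orders of poles combine by maximum, and the values [p(1)]
    of the summands of maximal order add up. So if [f] has a pole of order [a]
    with leading coefficient [mu], and [Y n] one of order [A n + B] with leading
    coefficient [y n], then the order [D] of [X] satisfies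
    [D n.+1 = max (a + D n) (A n + B)], which is eventually linear of slope
    [max a A <= c], and the leading coefficients eventually satisfy
    [e n.+1 = mu (e n) + y n] or this equation without one of its two terms
    ([linear_growth_rec]). Hence the degree is eventually an exponential
    polynomial [\sum_m m^n P_m(n)] with rational polynomials [P_m] and positive
    integers [m]. Its largest base [Mu] and the degree [L] of the coefficient of
    [Mu^n] determine its growth, and the limit is positive as degrees are
    ([ev_expoly_limit]). *)

(** * Well quasi-orders *)

Definition wqo (T : Type) (r : T -> T -> Prop) :=
  forall f : nat -> T, exists i j, (i < j)%N /\ r (f i) (f j).

Lemma iter_choice (T : Type) (Q : T -> Prop) (step : T -> T -> Prop) (x0 : T) :
  Q x0 -> (forall x, Q x -> exists y, Q y /\ step x y) ->
  exists f : nat -> T, [/\ f 0%N = x0, forall n, Q (f n)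
    & forall n, step (f n) (f n.+1)].
Proof.
move=> Q0 ex_step.
have /choice[g gP] : forall x, exists y, Q x -> Q y /\ step x y.
  move=> x; have [Qx|nQx] := pselect (Q x); last by exists x.
  by have [y ?] := ex_step x Qx; exists y.
pose f n := iter n g x0.
have Qf n : Q (f n) by elim: n => //= n IH; case: (gP _ IH).
by exists f; split=> // n; case: (gP _ (Qf n)).
Qed.

Lemma increasing_steps (f : nat -> nat) :
  (forall n, (f n < f n.+1)%N) -> forall i j, (i < j)%N -> (f i < f j)%N.
Proof.
move=> f_step i j; elim: j => // j IH; rewrite ltnS leq_eqVlt => /predU1P[->//|].
by move/IH/ltn_trans; apply.
Qed.

Lemma wqo_subseq (T : Type) (r : T -> T -> Prop) :
  (forall x y z, r x y -> r y z -> r x z) -> wqo r ->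
  forall f : nat -> T, exists g : nat -> nat,
    (forall i j, (i < j)%N -> (g i < g j)%N) /\
    (forall i j, (i < j)%N -> r (f (g i)) (f (g j))).
Proof.
move=> r_trans r_wqo f.
have [n0 n0P] : exists n0, forall i, (n0 <= i)%N ->
    exists j, (i < j)%N /\ r (f i) (f j).
  (* otherwise the indices without a larger successor form a bad sequence *)
  apply: contrapT => /forallNP terminal.
  have next n : exists i, (n <= i)%N /\ forall j, (i < j)%N -> ~ r (f i) (f j).
    have /existsNP[i] := terminal n; rewrite not_implyE => -[ni /forallNP nr].
    by exists i; split=> // j ij rij; apply: (nr j).
  have [i0 [_ i0P]] := next 0%N.
  have next_after i : (forall j, (i < j)%N -> ~ r (f i) (f j)) ->
      exists k, (forall j, (k < j)%N -> ~ r (f k) (f j)) /\ (i < k)%N.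
    by have [k [ik kP]] := next i.+1; exists k.
  have [g [_ gP gS]] := iter_choice i0P next_after.
  have [i [j [ij rij]]] := r_wqo (f \o g).
  by apply: gP rij; apply: increasing_steps ij.
have next i : (n0 <= i)%N ->
    exists k, (n0 <= k)%N /\ ((i < k)%N /\ r (f i) (f k)).
  move=> n0i; have [k [ik rik]] := n0P i n0i.
  by exists k; split=> //; apply: leq_trans n0i (ltnW ik).
have [g [_ gP gS]] :=
  @iter_choice _ (fun i => (n0 <= i)%N) _ _ (leqnn n0) next.
exists g; split; first by apply: increasing_steps => n; case: (gS n).
move=> i j; elim: j => // j IH; rewrite ltnS leq_eqVlt => /predU1P[->|ij].
  by case: (gS j).
by apply: r_trans (IH ij) _; case: (gS j).
Qed.

Lemma wqo_prod (T U : Type) (r : T -> T -> Prop) (s : U -> U -> Prop) :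
  (forall x y z, r x y -> r y z -> r x z) -> wqo r -> wqo s ->
  wqo (fun p q : T * U => r p.1 q.1 /\ s p.2 q.2).
Proof.
move=> r_trans r_wqo s_wqo f.
have [g [g_incr g_r]] := wqo_subseq r_trans r_wqo (fst \o f).
have [i [j [ij sij]]] := s_wqo (fun n => (f (g n)).2).
by exists (g i), (g j); split; [exact: g_incr|split=> //; exact: g_r].
Qed.

Lemma wqo_leq : wqo (fun m n : nat => (m <= n)%N).
Proof.
move=> f; apply: contrapT => /forallNP bad.
have dec i j : (i < j)%N -> (f j < f i)%N.
  move=> ij; rewrite ltnNge; apply/negP => le_f.
  by apply: (bad i); exists j.
have bound n : (f n + n <= f 0)%N.
  elim: n => [|n IH]; first by rewrite addn0.
  by rewrite addnS; apply: leq_trans IH; rewrite -addSn leq_add2r dec.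
by have := bound (f 0).+1; rewrite leqNgt addnS ltnS leq_addl.
Qed.

Lemma wqo_bool : wqo (@eq bool).
Proof.
move=> f; have [f01|f01] := eqVneq (f 0%N) (f 1%N); first by exists 0%N, 1%N.
have [f02|f02] := eqVneq (f 0%N) (f 2%N); first by exists 0%N, 2%N.
exists 1%N, 2%N; split=> //; move: f01 f02.
by case: (f 0%N) (f 1%N) (f 2%N) => -[] [].
Qed.

(** ** Higman's lemma *)

Section Higman.
Variables (T : Type) (r : T -> T -> Prop).

Inductive higman_le : seq T -> seq T -> Prop :=
| higman_nil : higman_le [::] [::]
| higman_skip x u v : higman_le u v -> higman_le u (x :: v)
| higman_cons x y u v : r x y -> higman_le u v -> higman_le (x :: u) (y :: v).

Lemma higman0s v : higman_le [::] v.
Proof. by elim: v => [|x v IH]; constructor. Qed.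

Lemma higman_refl : (forall x, r x x) -> forall u, higman_le u u.
Proof. by move=> r_refl; elim=> [|x u IH]; constructor. Qed.

Lemma higman_trans : (forall x y z, r x y -> r y z -> r x z) ->
  forall u v w, higman_le u v -> higman_le v w -> higman_le u w.
Proof.
move=> r_trans u v w uv vw; elim: vw u uv => {v w} [//|x v w _ IH|x y v w xy _ IH] u uv.
  by constructor; apply: IH.
inversion uv; subst; first by constructor; apply: IH.
by constructor; [apply: r_trans xy|apply: IH].
Qed.

Lemma higman_size u v : higman_le u v -> (size u <= size v)%N.
Proof. by elim=> //= *; apply: leqW. Qed.

Definition bad (f : nat -> seq T) := forall i j, (i < j)%N -> ~ higman_le (f i) (f j).

Definition extends (p : seq (seq T)) (f : nat -> seq T) :=
  forall i, (i < size p)%N -> f i = nth [::] p i.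

(** Nash-Williams: in a bad sequence that is lexicographically minimal for the
    lengths of its terms, the tails of a suitable subsequence again
    continue to a bad sequence. *)
Lemma higman : (forall x y z, r x y -> r y z -> r x z) -> wqo r -> wqo higman_le.
Proof.
move=> r_trans r_wqo f0; apply: contrapT => f0_good.
pose ext p := exists f, bad f /\ extends p f.
have ext0 : ext [::].
  exists f0; split=> // i j ij hij; apply: f0_good; exists i, j; split=> //.
have ext_next p : ext p -> exists q, ext q /\ exists2 w, q = rcons p w
    & forall w', ext (rcons p w') -> (size w <= size w')%N.
  move=> [f [f_bad f_p]].
  have [w0 w0P] : exists w, ext (rcons p w).
    exists (f (size p)), f; split=> // i; rewrite size_rcons ltnS nth_rcons.
    by case: ltngtP => // [/f_p //|->].
  pose Q n := `[< exists2 w, ext (rcons p w) & size w = n >].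
  have exQ : exists n, Q n by exists (size w0); apply/asboolP; exists w0.
  have := ex_minnP exQ => -[n /asboolP[w wP <-] w_min].
  exists (rcons p w); split=> //; exists w => // w' w'P.
  by apply: w_min; apply/asboolP; exists w'.
have [P [P0 P_ext PS]] := iter_choice ext0 ext_next.
have P_size n : size (P n) = n.
  by elim: n => [|n IH]; [rewrite P0|have [w -> _] := PS n; rewrite size_rcons IH].
pose G n := nth [::] (P n.+1) n.
have PSE n : P n.+1 = rcons (P n) (G n).
  by rewrite /G; have [w -> _] := PS n; rewrite nth_rcons P_size ltnn eqxx.
have G_min n w : ext (rcons (P n) w) -> (size (G n) <= size w)%N.
  have [w' e w'_min] := PS n; move: e; rewrite PSE => /rcons_inj[->]; exact: w'_min.
have P_nth n i : (i < n)%N -> nth [::] (P n) i = G i.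
  elim: n => // n IH; rewrite ltnS leq_eqVlt PSE nth_rcons P_size.
  by case/predU1P => [->|lt_in]; rewrite ?ltnn ?eqxx // lt_in IH.
have G_bad : bad G.
  move=> i j ij; have [f [f_bad f_P]] := P_ext j.+1.
  have fG k : (k < j.+1)%N -> f k = G k by move=> kj; rewrite f_P ?P_size // P_nth.
  by rewrite -!fG ?leqnn //; [exact: f_bad|exact: leqW].
have G_cons n : exists x u, G n = x :: u.
  case E: (G n) => [|x u]; last by exists x, u.
  by case: (G_bad n n.+1 (leqnn _)); rewrite E; apply: higman0s.
have [h hP] := choice G_cons.
have [tl GE] := choice hP.
have [s [s_incr s_r]] := wqo_subseq r_trans r_wqo h.
pose F n := if (n < s 0)%N then G n else tl (s (n - s 0)%N).
have FG n v : (s 0 <= n)%N -> higman_le v (F n) -> higman_le v (G (s (n - s 0)%N)).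
  by rewrite /F leqNgt => /negPf ->; rewrite GE; apply: higman_skip.
have s0_le n : (s 0 <= s n)%N by case: n => // n; apply/ltnW/s_incr.
have F_bad : bad F.
  move=> i j ij; have [lt_j|le_j] := ltnP j (s 0).
    by rewrite /F lt_j (ltn_trans ij lt_j); apply: G_bad.
  have [lt_i /(FG _ _ le_j)|le_i] := ltnP i (s 0).
    rewrite /F lt_i; apply: G_bad; exact: leq_trans lt_i (s0_le _).
  have lt_ij : (i - s 0 < j - s 0)%N by rewrite ltn_sub2r // (leq_ltn_trans le_i).
  rewrite /F ltnNge le_i ltnNge le_j /= => hij.
  apply: (G_bad _ _ (s_incr _ _ lt_ij)); rewrite !GE; apply: higman_cons => //.
  exact: s_r.
have : ext (rcons (P (s 0)) (tl (s 0))).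
  exists F; split=> // i; rewrite size_rcons P_size ltnS nth_rcons P_size leq_eqVlt.
  case/predU1P => [->|lt_i]; first by rewrite /F ltnn eqxx subnn.
  by rewrite /F lt_i P_nth.
by move/G_min; rewrite GE /= ltnn.
Qed.

Lemma higman_index x0 u v : higman_le u v ->
  exists f : nat -> nat, (forall i j, (i < j)%N -> (f i < f j)%N) /\
    (forall i, (i < size u)%N -> (f i < size v)%N /\ r (nth x0 u i) (nth x0 v (f i))).
Proof.
elim=> {u v} [|x u v _ [f [f_incr fP]]|x y u v xy _ [f [f_incr fP]]].
- by exists id.
- exists (succn \o f); split=> [i j /f_incr //|i iu]; exact: fP.
- exists (fun i => if i is i'.+1 then (f i').+1 else 0%N); split.
    by case=> [|i] [|j] //; rewrite !ltnS; apply: f_incr.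
  by case=> [|i] //= iu; apply: fP.
Qed.

Lemma higman_pointwise x0 u v : higman_le u v -> size u = size v ->
  forall i, (i < size u)%N -> r (nth x0 u i) (nth x0 v i).
Proof.
elim=> {u v} // [x u v /higman_size le_uv _ /= e|x y u v xy _ IH [/IH{}IH] [|i] //].
  by rewrite e ltnn in le_uv.
exact: IH.
Qed.

End Higman.

(** ** Order ideals *)

Definition downset (T : Type) (r : T -> T -> Prop) (S : set T) :=
  forall u v, r u v -> S v -> S u.

(** A strictly decreasing chain of order ideals would give a bad sequence:
    choose in each ideal an element outside of the next one. *)
Lemma downset_ind (T : Type) (r : T -> T -> Prop) : wqo r ->
  forall Q : set T -> Prop,
  (forall S, downset r S ->
     (forall S', downset r S' -> S' `<=` S -> S' <> S -> Q S') -> Q S) ->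
  forall S, downset r S -> Q S.
Proof.
move=> r_wqo Q step S dS; apply: contrapT => nQS.
pose B S := downset r S /\ ~ Q S.
have next S1 : B S1 -> exists S2, B S2 /\ S2 `<=` S1 /\ S2 <> S1.
  move=> [dS1 nQ]; apply: contrapT => none; apply: nQ; apply: step => // S2 dS2 le ne.
  by apply: contrapT => nQ2; apply: none; exists S2.
have [C [_ C_B C_step]] := iter_choice (conj dS nQS : B S) next.
have /choice[w wP] n : exists w, C n w /\ ~ C n.+1 w.
  have [le ne] := C_step n; apply: contrapT => none; apply: ne.
  rewrite eqEsubset; split=> // x Cx; apply: contrapT => nCx.
  by apply: none; exists x.
have C_dec i j : (i <= j)%N -> C j `<=` C i.
  elim: j => [|j IH]; first by rewrite leqn0 => /eqP ->.
  rewrite leq_eqVlt => /predU1P[->//|/IH le]; apply: subset_trans le.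
  by case: (C_step j).
have [i [j [ij wij]]] := r_wqo w.
have [_ []] := wP i; apply: (C_B i.+1).1 wij _.
by apply: C_dec ij _ _; case: (wP j).
Qed.

(** * Power series with a pole at 1 *)

Definition cauchy_prod (f g : nat -> nat) (j : nat) : nat :=
  (\sum_(i < j.+1) f i * g (j - i))%N.

Definition trunc N (f : nat -> nat) : {poly int} := \poly_(i < N) (f i)%:Z.

(** Power series are compared through their truncations, so that products can be
    computed with polynomials. *)
Definition eq_upto N (p q : {poly int}) := forall i, (i < N)%N -> p`_i = q`_i.

Lemma eq_upto_mul N p p' q q' : eq_upto N p p' -> eq_upto N q q' ->
    eq_upto N (p * q) (p' * q').
Proof.
move=> pp qq i iN; rewrite !coefM; apply: eq_bigr => -[j /=]; rewrite ltnS => ji _.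
by rewrite pp ?qq //; apply: leq_ltn_trans iN; rewrite ?leq_subr.
Qed.

Lemma trunc_add N f g : trunc N (fun j => (f j + g j)%N) = trunc N f + trunc N g.
Proof. by apply/polyP => i; rewrite coefD !coef_poly; case: ifP; rewrite ?PoszD. Qed.

Lemma trunc_cauchy_prod N f g :
    eq_upto N (trunc N (cauchy_prod f g)) (trunc N f * trunc N g).
Proof.
move=> m mN; rewrite coefM coef_poly mN /cauchy_prod (big_morph Posz PoszD (erefl _)); apply: eq_bigr => -[i /=].
rewrite ltnS => im _; rewrite !coef_poly (leq_ltn_trans im) //.
by rewrite (leq_ltn_trans (leq_subr _ _)).
Qed.

(** As power series, f(t) = p(t) / (1 - t)^D with p(1) = e. *)
Definition has_pole (f : nat -> nat) (D : nat) (e : int) := exists2 p : {poly int},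
  p.[1] = e & forall N, eq_upto N ((1 - 'X) ^+ D * trunc N f) p.

Lemma has_poleE f D p : (forall N, eq_upto N ((1 - 'X) ^+ D * trunc N f) p) <->
  forall m, \sum_(i < m.+1) ((1 - 'X) ^+ D : {poly int})`_i * (f (m - i)%N)%:Z = p`_m.
Proof.
split=> fp m; [rewrite -(fp m.+1) // coefM|move=> i im; rewrite -fp coefM];
  apply: eq_bigr => -[j /=]; rewrite ltnS => jm _; rewrite coef_poly.
  by rewrite ltnS leq_subr.
by rewrite (leq_ltn_trans (leq_subr _ _)).
Qed.

Lemma has_pole_ext f g D e : f =1 g -> has_pole f D e -> has_pole g D e.
Proof.
move=> fg [p p1 fp]; exists p => // N.
suff -> : trunc N g = trunc N f by [].
by apply/polyP => j; rewrite !coef_poly fg.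
Qed.

(** The numerator [(1 - t)^k p(t)] vanishes at 1 unless [k = 0]. *)
Lemma has_pole_raise f D e k : has_pole f D e ->
    has_pole f (D + k) (if k is 0%N then e else 0).
Proof.
move=> [p p1 fp]; exists ((1 - 'X) ^+ k * p).
  rewrite hornerM horner_exp !hornerE subrr p1; case: k => [|k].
    by rewrite expr0 mul1r.
  by rewrite expr0n mul0r.
by move=> N; rewrite addnC exprD -mulrA; apply: eq_upto_mul.
Qed.

Lemma has_pole_add f g D a b : has_pole f D a -> has_pole g D b ->
  has_pole (fun j => (f j + g j)%N) D (a + b).
Proof.
move=> [p p1 fp] [q q1 gq]; exists (p + q); first by rewrite hornerD p1 q1.
by move=> N i iN; rewrite trunc_add mulrDr !coefD fp ?gq.
Qed.

Lemma has_pole_addl f g D D' a b : (D' < D)%N -> has_pole f D a -> has_pole g D' b ->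
  has_pole (fun j => (f j + g j)%N) D a.
Proof.
move=> lt fa /(has_pole_raise (D - D')) gb; rewrite -[a]addr0; apply: has_pole_add =>
    //.
move: gb; rewrite subnKC ?(ltnW lt) //.
by move: lt; rewrite -subn_gt0; case: (_ - _)%N.
Qed.

Lemma has_pole_addr f g D D' a b : (D' < D)%N -> has_pole f D' b -> has_pole g D a ->
  has_pole (fun j => (f j + g j)%N) D a.
Proof.
move=> lt fb ga; apply: has_pole_ext (has_pole_addl lt ga fb) => j; exact: addnC.
Qed.

Lemma has_pole_cauchy_prod f g D D' a b : has_pole f D a -> has_pole g D' b ->
    has_pole (cauchy_prod f g) (D + D') (a * b).
Proof.
move=> [p p1 fp] [q q1 gq]; exists (p * q); first by rewrite hornerM p1 q1.
move=> N i iN; rewrite -(eq_upto_mul (fp N) (gq N)) // mulrACA -exprD.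
by apply: eq_upto_mul iN => //; apply: trunc_cauchy_prod.
Qed.

Lemma has_pole_monomial a : has_pole (fun i => i == a) 0 1.
Proof.
exists 'X^a; first by rewrite hornerXn expr1n.
by move=> N i iN; rewrite expr0 mul1r coef_poly iN coefXn; case: eqP.
Qed.

Lemma has_pole_step a : has_pole (fun i => (a <= i)%N) 1 1.
Proof.
exists 'X^a; first by rewrite hornerXn expr1n.
move=> N i iN; rewrite expr1 mulrBl mul1r coefB coefXM !coef_poly iN coefXn.
case: i iN => [|i] iN /=; first by rewrite subr0 leqn0; case: a.
rewrite (ltnW iN); case: (ltngtP a i.+1) => [ai|ai|->].
- by rewrite -ltnS ai subrr.
- by rewrite leqNgt (ltnW ai) subr0.
- by rewrite ltnn subr0.
Qed.

(** A representation with a larger exponent has a numerator that vanishes at 1. *)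
Lemma has_pole_uniq f D D' e e' : e != 0 -> e' != 0 -> has_pole f D e ->
    has_pole f D' e' ->
  D = D' /\ e = e'.
Proof.
have key D1 D2 e1 e2 : has_pole f D1 e1 -> has_pole f D2 e2 -> (D1 <= D2)%N ->
    e2 = if (D2 - D1)%N is 0%N then e1 else 0.
  move=> /(has_pole_raise (D2 - D1)) [p <- fp] [q <- fq] le; rewrite subnKC // in fp.
  suff -> : p = q by [].
  by apply/polyP => i; rewrite -(fp i.+1) // -(fq i.+1).
move=> e0 e0' h h'; case: (leqP D D') => le.
  have := key _ _ _ _ h h' le; case E: (D' - D)%N => [|k] ee.
    by split=> //; apply/eqP; rewrite eqn_leq le -subn_eq0 E.
  by rewrite ee eqxx in e0'.
have := key _ _ _ _ h' h (ltnW le); rewrite -subn_gt0 in le.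
by case: (_ - _)%N le => // k _ ee; rewrite ee eqxx in e0.
Qed.

(** Positivity of the leading coefficient prevents cancellation in sums. *)
Definition zero_or_pole (f : nat -> nat) :=
  (forall j, f j = 0%N) \/ exists D e, 0 < e /\ has_pole f D e.

Lemma cauchy_prod0s f g : (forall j, f j = 0%N) -> forall j, cauchy_prod f g j = 0%N.
Proof. by move=> f0 j; apply: big1 => i _; rewrite f0. Qed.

Lemma cauchy_prods0 f g : (forall j, g j = 0%N) -> forall j, cauchy_prod f g j = 0%N.
Proof. by move=> g0 j; apply: big1 => i _; rewrite g0 muln0. Qed.

Lemma zero_or_pole_cauchy_prod f g : zero_or_pole f -> zero_or_pole g ->
    zero_or_pole (cauchy_prod f g).
Proof.
move=> [f0|[D [a [a0 fa]]]]; first by left; apply: cauchy_prod0s.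
move=> [g0|[D' [b [b0 gb]]]]; first by left; apply: cauchy_prods0.
by right; exists (D + D')%N, (a * b); rewrite mulr_gt0 //; split=> //;
    apply: has_pole_cauchy_prod.
Qed.

Lemma has_pole_add_max f g D D' a b : 0 < a -> 0 < b -> has_pole f D a ->
    has_pole g D' b ->
  exists e, 0 < e /\ has_pole (fun j => (f j + g j)%N) (maxn D D') e.
Proof.
move=> a0 b0 fa gb; case: (ltngtP D D') => [lt|lt|eqD].
- by exists b; split=> //; apply: has_pole_addr lt fa gb.
- by exists a; split=> //; apply: has_pole_addl lt fa gb.
- by exists (a + b); rewrite addr_gt0 //; split=> //; rewrite eqD in fa *;
    apply: has_pole_add.
Qed.

Lemma zero_or_pole_ext f g : f =1 g -> zero_or_pole f -> zero_or_pole g.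
Proof.
move=> fg [f0|[D [a [a0 fa]]]]; first by left=> j; rewrite -fg.
by right; exists D, a; split=> //; apply: has_pole_ext fa.
Qed.

Lemma zero_or_pole_add f g : zero_or_pole f -> zero_or_pole g ->
    zero_or_pole (fun j => (f j + g j)%N).
Proof.
move=> [f0 ng|[D [a [a0 fa]]]]; first by apply: zero_or_pole_ext ng => j; rewrite f0.
move=> [g0|[D' [b [b0 gb]]]].
  by right; exists D, a; split=> //; apply: has_pole_ext fa => j; rewrite g0 addn0.
right; exists (maxn D D'); exact: (has_pole_add_max a0 b0 fa gb).
Qed.

(** * Exponential polynomials *)

Definition bin_eval (p : {poly rat}) (n : nat) : rat :=
  \sum_(k < size p) p`_k * 'C(n, k)%:R.

(** The exponential polynomials with bases 1, 2, 3, ...; writing the polynomials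
    in the basis of binomial coefficients makes difference equations
    triangular. *)
Definition exp_eval (P : {poly {poly rat}}) (n : nat) : rat :=
  \sum_(m < size P) m.+1%:R ^+ n * bin_eval P`_m n.

Lemma bin_eval_wide (p : {poly rat}) n N : (size p <= N)%N ->
  bin_eval p n = \sum_(k < N) p`_k * 'C(n, k)%:R.
Proof.
move=> le; rewrite /bin_eval (big_ord_widen N (fun k => p`_k * 'C(n, k)%:R)) //.
rewrite big_mkcond; apply: eq_bigr => i _; case: ltnP => // le_i.
by rewrite nth_default // mul0r.
Qed.

Lemma exp_eval_wide (P : {poly {poly rat}}) n N : (size P <= N)%N ->
  exp_eval P n = \sum_(m < N) m.+1%:R ^+ n * bin_eval P`_m n.
Proof.
move=> le; rewrite /exp_eval (big_ord_widen N (fun m =>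
    m.+1%:R ^+ n * bin_eval P`_m n)) //.
rewrite big_mkcond; apply: eq_bigr => i _; case: ltnP => // le_i.
by rewrite nth_default // /bin_eval size_poly0 big_ord0 mulr0.
Qed.

Lemma bin_evalD p q n : bin_eval (p + q) n = bin_eval p n + bin_eval q n.
Proof.
pose N := maxn (size p) (size q).
rewrite !(@bin_eval_wide _ _ N) ?size_polyD ?leq_maxl ?leq_maxr //.
by rewrite -big_split; apply: eq_bigr => i _; rewrite coefD mulrDl.
Qed.

Definition expoly (y : nat -> rat) := exists P, y =1 exp_eval P.

Lemma expoly_add y z : expoly y -> expoly z -> expoly (fun n => y n + z n).
Proof.
move=> [P yP] [Q zQ]; exists (P + Q) => n; rewrite yP zQ.
pose N := maxn (size P) (size Q).
rewrite !(@exp_eval_wide _ _ N) ?size_polyD ?leq_maxl ?leq_maxr //.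
by rewrite -big_split; apply: eq_bigr => i _; rewrite coefD bin_evalD mulrDr.
Qed.

Lemma expoly_basis c m k : expoly (fun n => c * (m.+1%:R ^+ n * 'C(n, k)%:R)).
Proof.
exists ((c *: 'X^k)%:P * 'X^m) => n.
have bk : bin_eval (c *: 'X^k) n = c * 'C(n, k)%:R.
  rewrite (@bin_eval_wide _ _ k.+1); last first.
    by rewrite (leq_trans (size_scale_leq _ _)) // size_polyXn.
  rewrite (bigD1 ord_max) //= big1 => [|i ne].
    by rewrite coefZ coefXn eqxx mulr1 addr0.
  by rewrite coefZ coefXn -val_eqE in ne *; rewrite (negPf ne) mulr0 mul0r.
rewrite (@exp_eval_wide _ _ m.+1); last first.
  rewrite (leq_trans (size_polyMleq _ _)) // size_polyXn addnS /=.
  by rewrite -[leqRHS]add1n leq_add2r size_polyC leq_b1.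
rewrite (bigD1 ord_max) //= big1 => [|i ne].
  by rewrite coefMXn ltnn subnn coefC eqxx bk addr0 mulrCA.
have lt_i : (i < m)%N by rewrite ltn_neqAle -ltnS ltn_ord andbT.
by rewrite coefMXn lt_i /bin_eval size_poly0 big_ord0 mulr0.
Qed.

Lemma expoly0 : expoly (fun=> 0).
Proof. by exists 0 => n; rewrite /exp_eval size_poly0 big_ord0. Qed.

(** By Pascal's rule, ['C(n, k.+1)] solves the equation when the base of
    the exponential is [mu] (resonance); otherwise induct on [k]. *)
Lemma solve_basis (mu : nat) c m k : exists2 z, expoly z &
  forall n, z n.+1 = mu%:R * z n + c * (m.+1%:R ^+ n * 'C(n, k)%:R).
Proof.
have mR : (m.+1%:R : rat) != 0 by rewrite pnatr_eq0.
have [->|ne] := eqVneq mu m.+1.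
  exists (fun n => (c / m.+1%:R) * (m.+1%:R ^+ n * 'C(n, k.+1)%:R)).
    exact: expoly_basis.
  by move=> n; rewrite binS natrD exprS; field.
have d0 : (m.+1%:R - mu%:R : rat) != 0 by rewrite subr_eq0 eqr_nat eq_sym.
elim: k c => [|k IH] c.
  exists (fun n => (c / (m.+1%:R - mu%:R)) * (m.+1%:R ^+ n * 'C(n, 0)%:R)).
    exact: expoly_basis.
  move=> n; rewrite !bin0 exprS.
  by move: (m.+1%:R : rat) (mu%:R : rat) d0 => a b d0; field.
have [z z_repr zS] := IH (- (c * m.+1%:R / (m.+1%:R - mu%:R))).
exists (fun n => (c / (m.+1%:R - mu%:R)) * (m.+1%:R ^+ n * 'C(n, k.+1)%:R) + z n).
  by apply: expoly_add z_repr; apply: expoly_basis.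
move=> n; rewrite zS binS natrD exprS.
by move: (m.+1%:R : rat) (mu%:R : rat) d0 => a b d0; field.
Qed.

(** Linear difference equations of order one can be solved term by term. *)
Lemma solve_expoly (mu : nat) y : expoly y -> exists2 z, expoly z &
  forall n, z n.+1 = mu%:R * z n + y n.
Proof.
move=> [P yP]; pose sol (y : nat -> rat) := exists2 z, expoly z &
  forall n, z n.+1 = mu%:R * z n + y n.
have sol_ext y1 y2 : y1 =1 y2 -> sol y1 -> sol y2.
  by move=> e [z rz zP]; exists z => // n; rewrite -e.
have sol_sum N (F : nat -> nat -> rat) : (forall i, sol (F i)) ->
    sol (fun n => \sum_(i < N) F i n).
  move=> solF; elim: N => [|N [z rz zP]].
    exists (fun=> 0); first exact: expoly0.
    by move=> n; rewrite big_ord0 mulr0 addr0.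
  have [w rw wP] := solF N; exists (fun n => z n + w n); first exact: expoly_add.
  by move=> n; rewrite zP wP big_ord_recr /= mulrDr addrACA.
suff: sol (fun n => \sum_(m < size P) \sum_(k < size P`_m)
    P`_m`_k * (m.+1%:R ^+ n * 'C(n, k)%:R)).
  apply: sol_ext => n; rewrite yP; apply: eq_bigr => m _; rewrite /bin_eval mulr_sumr.
  by apply: eq_bigr => k _; rewrite mulrCA.
apply: (sol_sum _ (fun m n => \sum_(k < size P`_m)
    P`_m`_k * (m.+1%:R ^+ n * 'C(n, k)%:R))) => m.
apply: (sol_sum _ (fun k n => P`_m`_k * (m.+1%:R ^+ n * 'C(n, k)%:R))) => k.
exact: solve_basis.
Qed.

Definition ev_expoly (e : nat -> int) :=
  exists2 y, expoly y & exists n0, forall n, (n0 <= n)%N -> (e n)%:~R = y n.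

Lemma ev_expoly_add a b : ev_expoly a -> ev_expoly b -> ev_expoly (fun n => a n + b n).
Proof.
move=> [y ry [n0 yP]] [z rz [n1 zP]].
exists (fun n => y n + z n); first exact: expoly_add.
exists (maxn n0 n1) => n; rewrite geq_max => /andP[le0 le1].
by rewrite rmorphD /= yP ?zP.
Qed.

Lemma ev_expoly0 : ev_expoly (fun=> 0).
Proof. by exists (fun=> 0); [exact: expoly0|exists 0%N]. Qed.

Lemma ev_expoly_rec (mu : nat) y e n0 : ev_expoly y ->
  (forall n, (n0 <= n)%N -> e n.+1 = mu%:Z * e n + y n) -> ev_expoly e.
Proof.
move=> [y' ry [n1 yP]] eS; have [z rz zS] := solve_expoly mu ry.
pose n2 := maxn n0 n1; pose d := (e n2)%:~R - z n2.
(* the difference of two solutions is geometric *)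
have eE k : (e (n2 + k)%N)%:~R = z (n2 + k)%N + mu%:R ^+ k * d.
  elim: k => [|k IH]; first by rewrite addn0 expr0 mul1r addrC subrK.
  have [le0 le1] : (n0 <= n2 + k)%N /\ (n1 <= n2 + k)%N.
    by split; apply: leq_trans (leq_addr _ _); rewrite ?leq_maxl ?leq_maxr.
  rewrite addnS eS // rmorphD rmorphM /= IH zS yP // exprS -pmulrn.
  by ring.
case: mu zS eS eE => [|mu] zS eS eE.
  exists z => //; exists n2.+1 => n lt; rewrite -(subnKC (ltnW lt)) eE.
  by rewrite expr0n subn_eq0 leqNgt lt mul0r addr0.
exists (fun n => z n + (d / mu.+1%:R ^+ n2) * (mu.+1%:R ^+ n * 'C(n, 0)%:R)).
  by apply: expoly_add rz _; apply: expoly_basis.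
exists n2 => n le; rewrite -(subnKC le) eE bin0 exprD.
have m0 : (mu.+1%:R : rat) ^+ n2 != 0 by rewrite expf_neq0 // pnatr_eq0.
by field.
Qed.

(** * Sequences of series with linear dimension *)

(** For the Hilbert series [X n] of a module, [D] is the dimension and [e n] is the
    degree. *)
Definition linear_growth (c : nat) (X : nat -> nat -> nat) :=
  (forall n, zero_or_pole (X n)) /\
  ((exists n0, forall n, (n0 <= n)%N -> forall j, X n j = 0%N) \/
   exists (A : nat) (B : int) (e : nat -> int) (n0 : nat),
     [/\ (A <= c)%N, ev_expoly e & forall n, (n0 <= n)%N ->
       0 < e n /\ exists2 D : nat, D%:Z = A%:Z * n%:Z + B & has_pole (X n) D (e n)]).

Lemma linear_growth_ext c X Y : (forall n j, X n j = Y n j) -> linear_growth c X ->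
    linear_growth c Y.
Proof.
move=> XY [nX X_ev]; split=> [n|]; first by apply: zero_or_pole_ext (nX n); exact: XY.
case: X_ev => [[n0 X0]|[A [B [e [n0 [Ac ee eP]]]]]].
  by left; exists n0 => n le j; rewrite -XY X0.
right; exists A, B, e, n0; split=> // n /eP[e0 [D DE XD]]; split=> //.
by exists D => //; apply: has_pole_ext XD; exact: XY.
Qed.

Lemma linear_growth_cauchy_prod c f D X : has_pole f D 1 -> linear_growth c X ->
  linear_growth c (fun n => cauchy_prod f (X n)).
Proof.
move=> fD [nX X_ev]; split=> [n|].
  by apply: zero_or_pole_cauchy_prod (nX n); right; exists D, 1.
case: X_ev => [[n0 X0]|[A [B [e [n0 [Ac ee eP]]]]]].
  by left; exists n0 => n le j; apply: cauchy_prods0 => i; apply: X0.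
right; exists A, (B + D%:Z), e, n0; split=> // n /eP[e0 [D' DE XD]]; split=> //.
exists (D + D')%N; first by rewrite PoszD DE; ring.
by rewrite -[e n]mul1r; apply: has_pole_cauchy_prod.
Qed.

Lemma lin_cmp (A A' : nat) (B B' : int) : exists n0 : nat,
  [\/ forall n, (n0 <= n)%N -> A%:Z * n%:Z + B < A'%:Z * n%:Z + B',
      forall n, (n0 <= n)%N -> A%:Z * n%:Z + B = A'%:Z * n%:Z + B'
    | forall n, (n0 <= n)%N -> A'%:Z * n%:Z + B' < A%:Z * n%:Z + B].
Proof.
exists (`|B| + `|B'|).+1%N; case: (ltngtP A A') => [lt|lt|<-].
- by apply: Or31 => n le; nia.
- by apply: Or33 => n le; nia.
case: (ltgtP B B') => cmp; [apply: Or31|apply: Or33|apply: Or32] => n le; lia.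
Qed.

Lemma linear_growth_add c X Y : linear_growth c X -> linear_growth c Y ->
  linear_growth c (fun n j => (X n j + Y n j)%N).
Proof.
move=> [nX X_ev] [nY Y_ev]; split=> [n|]; first exact: zero_or_pole_add.
case: X_ev => [[n0 X0]|[A [B [e [n0 [Ac ee eP]]]]]].
  case: Y_ev => [[n1 Y0]|[A' [B' [e' [n1 [Ac' ee' eP']]]]]].
    left; exists (maxn n0 n1) => n; rewrite geq_max => /andP[l0 l1] j.
    by rewrite X0 ?Y0.
  right; exists A', B', e', (maxn n0 n1); split=> // n.
  rewrite geq_max => /andP[l0 l1]; have [e0 [D DE YD]] := eP' n l1; split=> //.
  by exists D => //; apply: has_pole_ext YD => j; rewrite X0.
case: Y_ev => [[n1 Y0]|[A' [B' [e' [n1 [Ac' ee' eP']]]]]].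
  right; exists A, B, e, (maxn n0 n1); split=> // n.
  rewrite geq_max => /andP[l0 l1]; have [e0 [D DE XD]] := eP n l0; split=> //.
  by exists D => //; apply: has_pole_ext XD => j; rewrite Y0 ?addn0.
have [n2 cmp] := lin_cmp A A' B B'.
right; case: cmp => cmp.
- exists A', B', e', (maxn n0 (maxn n1 n2)); split=> // n.
  rewrite !geq_max => /and3P[/eP[e0 [D DE XD]] /eP'[e0' [D' DE' YD]] /cmp].
  rewrite -DE -DE' => lt; split=> //; exists D' => //.
  exact: has_pole_addr lt XD YD.
- exists A, B, (fun n => e n + e' n), (maxn n0 (maxn n1 n2)); split=> //.
    exact: ev_expoly_add.
  move=> n.
  rewrite !geq_max => /and3P[/eP[e0 [D DE XD]] /eP'[e0' [D' DE' YD]] /cmp].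
  rewrite -DE -DE' => -[eqD]; split; first exact: addr_gt0.
  by exists D => //; rewrite -eqD in YD; apply: has_pole_add.
- exists A, B, e, (maxn n0 (maxn n1 n2)); split=> // n.
  rewrite !geq_max => /and3P[/eP[e0 [D DE XD]] /eP'[e0' [D' DE' YD]] /cmp].
  rewrite -DE -DE' => lt; split=> //; exists D => //.
  exact: has_pole_addl lt XD YD.
Qed.

(** The last hypothesis says that from [n1] on the pole order grows by [A] in each
    step and the leading coefficient obeys the recursion [e' = u e + z]. *)
Lemma linear_growth_geom c (X : nat -> nat -> nat) A n1 D1 e1 (u : nat) z :
  (forall n, zero_or_pole (X n)) -> (A <= c)%N -> ev_expoly z -> 0 < e1 ->
      has_pole (X n1) D1 e1 ->
  (forall k e, 0 < e -> has_pole (X (n1 + k)%N) (D1 + A * k) e ->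
     0 < u%:Z * e + z (n1 + k)%N /\
     has_pole (X (n1 + k).+1) (D1 + A * k.+1) (u%:Z * e + z (n1 + k)%N)) ->
  linear_growth c X.
Proof.
move=> nX Ac ez e1_gt0 h1 step; split=> //; right.
pose E := nat_rect (fun=> int) e1 (fun k e => u%:Z * e + z (n1 + k)%N).
have E_P k : 0 < E k /\ has_pole (X (n1 + k)%N) (D1 + A * k) (E k).
  elim: k => [|k [IH1 IH2]]; first by rewrite muln0 !addn0.
  by rewrite addnS; apply: step.
exists A, (D1%:Z - A%:Z * n1%:Z), (fun n => E (n - n1)%N), n1; split=> //.
  by apply: (@ev_expoly_rec u z _ n1) => // n le; rewrite subSn //= subnKC.
move=> n le; have [E0 hE] := E_P (n - n1)%N; split=> //.
rewrite subnKC // in hE; exists (D1 + A * (n - n1))%N => //.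
by have := mulnDr A n1 (n - n1)%N; rewrite subnKC //; lia.
Qed.

Definition zero_or_pole_le c (f : nat -> nat) := (forall j, f j = 0%N) \/
  exists (a mu : nat), [/\ (a <= c)%N, (0 < mu)%N & has_pole f a mu%:Z].

(** Let [f] have a pole of order [a] and let [Y] have slope [A]. The order of the
    pole of [X n.+1] is the maximum of those of [f * X n] and [Y n]. If [a < A],
    then the second one wins for good, if [a > A], then the first one does, and
    if [a = A], then the difference of the two is eventually constant. In each
    case the leading coefficients eventually obey one linear recursion. *)
Lemma linear_growth_rec c f X Y : zero_or_pole_le c f -> linear_growth c Y ->
    zero_or_pole (X 0%N) ->
  (forall n j, X n.+1 j = (cauchy_prod f (X n) j + Y n j)%N) -> linear_growth c X.
Proof.
move=> nf [nY Y_ev] nX0 XS.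
have zp_f : zero_or_pole f.
  by case: nf => [f0|[a [mu [_ m0 fa]]]]; [left|right; exists a, mu%:Z].
have nX n : zero_or_pole (X n).
  elim: n => // n IH;
      apply: zero_or_pole_ext (zero_or_pole_add (zero_or_pole_cauchy_prod zp_f IH) (nY n)) => j.
  by rewrite XS.
case: nf => [f0|[a [mu [ac m0 fa]]]].
  have XSY n j : X n.+1 j = Y n j by rewrite XS cauchy_prod0s.
  split=> //; case: Y_ev => [[n0 Y0]|[A [B [e [n0 [Ac ee eP]]]]]].
    by left; exists n0.+1 => -[//|n] le j; rewrite XSY Y0.
  right; exists A, (B - A%:Z), (fun n => e n.-1), n0.+1; split=> //.
    by apply: (@ev_expoly_rec 0 e _ 0) => // n _; rewrite mul0r add0r.
  move=> [//|n] /eP[e0 [D DE YD]]; split=> //; exists D; first by rewrite DE; lia.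
  by apply: has_pole_ext YD => j; rewrite XSY.
have prod_pole n D e : 0 < e -> has_pole (X n) D e ->
    0 < mu%:Z * e /\ has_pole (cauchy_prod f (X n)) (a + D) (mu%:Z * e).
  by move=> e0 XD; rewrite mulr_gt0 //; split=> //; apply: has_pole_cauchy_prod.
case: Y_ev => [[n0 Y0]|[A [B [y [n0 [Ac ey yP]]]]]].
  have XSf n : (n0 <= n)%N -> X n.+1 =1 cauchy_prod f (X n).
    by move=> le j; rewrite XS Y0 // addn0.
  case: (nX n0) => [X0|[D1 [e1 [e1_gt0 X1]]]].
    split=> //; left; exists n0 => n le; rewrite -(subnKC le).
    elim: (n - n0)%N => [|k IH] j; first by rewrite addn0.
    by rewrite addnS XSf ?leq_addr // cauchy_prods0.
  apply: (@linear_growth_geom _ _ a n0 D1 e1 mu (fun=> 0)) => //;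
      first exact: ev_expoly0.
  move=> k e e0 /(prod_pole _ _ _ e0)[me0 h]; rewrite addr0; split=> //.
  rewrite mulnS addnCA; apply: has_pole_ext h => j; rewrite XSf //; exact: leq_addr.
pose l (n : nat) : int := A%:Z * n%:Z + B.
have lS n : l n.+1 = l n + A%:Z by rewrite /l; lia.
have lD n k : l (n + k)%N = l n + (A * k)%N%:Z by rewrite /l; lia.
have yl n : (n0 <= n)%N -> 0 < y n /\ exists2 D : nat, D%:Z =
    l n & has_pole (Y n) D (y n).
  exact: yP.
have poleX n D e : has_pole (fun j => (cauchy_prod f (X n) j + Y n j)%N) D e ->
    has_pole (X n.+1) D e.
  by apply: has_pole_ext => j; rewrite XS.
pose st n D e := 0 < e /\ has_pole (X n) D e.
have step_gt n D e : (n0 <= n)%N -> l n < (a + D)%N -> st n D e ->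
    st n.+1 (a + D)%N (mu%:Z * e).
  move=> /yl[y0 [D' <- YD]] lt [e0 /(prod_pole _ _ _ e0)[me0 h]]; split=> //.
  by apply: poleX; apply: has_pole_addl lt h YD.
have step_eq n D e : (n0 <= n)%N -> l n = (a + D)%N -> st n D e ->
    st n.+1 (a + D)%N (mu%:Z * e + y n).
  move=> /yl[y0 [D' <- YD]] [eqD] [e0 /(prod_pole _ _ _ e0)[me0 h]].
  split; first exact: addr_gt0.
  by apply: poleX; apply: has_pole_add h _; rewrite -eqD.
have step_lt n D e : (n0 <= n)%N -> (a + D)%N%:Z < l n -> st n D e ->
    exists2 D' : nat, D'%:Z = l n & st n.+1 D' (y n).
  move=> /yl[y0 [D' DE YD]] lt [e0 /(prod_pole _ _ _ e0)[me0 h]]; exists D' => //.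
  by split=> //; apply: poleX; rewrite -DE in lt; apply: has_pole_addr lt h YD.
have step_any n D e : (n0 <= n)%N -> st n D e ->
    exists D' e', st n.+1 D' e' /\ D'%:Z = Num.max (l n) (a + D)%N%:Z.
  move=> le h; case: (ltgtP (l n) (a + D)%N) => cmp.
  - by exists (a + D)%N, (mu%:Z * e); split=> //; exact: step_gt.
  - have [D' DE hD] := step_lt n D e le cmp h.
    by exists D', (y n).
  - exists (a + D)%N, (mu%:Z * e + y n).
    by split=> //; exact: step_eq.
have [n1 [D1 [e1 [le1 h1]]]] : exists n1 D1 e1, (n0 <= n1)%N /\ st n1 D1 e1.
  case: (nX n0) => [X0|[D1 [e1 [e1_gt0 X1]]]]; last by exists n0, D1, e1.
  have [y0 [D DE YD]] := yl n0 (leqnn _); exists n0.+1, D, (y n0); split=> //.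
  by split=> //; apply: poleX; apply: has_pole_ext YD => j; rewrite cauchy_prods0.
case: (ltngtP a A) => [ltA|gtA|eqA].
- have [n2 [D2 [e2 [le2 lt2 h2]]]] : exists n2 D2 e2,
      [/\ (n0 <= n2)%N, (a + D2)%N%:Z < l n2 & st n2 D2 e2].
    have [N] : exists N : nat, (a + D1)%N%:Z < l n1 + N%:Z.
      by exists (`|(a + D1)%N%:Z - l n1|.+1); lia.
    elim: N n1 D1 e1 le1 h1 => [|N IH] n1 D1 e1 le1 h1 ltN.
      by exists n1, D1, e1; split=> //; lia.
    have [lt|ge] := ltP (a + D1)%N%:Z (l n1); first by exists n1, D1, e1.
    have [D' [e' [h' DE']]] := step_any _ _ _ le1 h1.
    rewrite max_r // in DE'.
    by apply: (IH n1.+1 D' e') => //; [exact: leqW|rewrite lS; lia].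
  have [D3 DE3 h3] := step_lt _ _ _ le2 lt2 h2.
  apply: (@linear_growth_geom _ _ A n2.+1 D3 (y n2) 0 y) => //; try by case: h3.
  move=> k e e0 hk; rewrite mul0r add0r.
  have le : (n0 <= n2.+1 + k)%N by rewrite (leq_trans le2) // addSn ltnW ?ltnS ?leq_addr.
  have [|D' DE' [y0 hD']] := step_lt _ _ _ le _ (conj e0 hk).
    by rewrite lD lS -DE3; lia.
  split=> //; suff <- : D' = (D3 + A * k.+1)%N by [].
  by move: DE'; rewrite lD lS -DE3; lia.
- have [n2 [D2 [e2 [le2 lt2 h2]]]] : exists n2 D2 e2,
      [/\ (n0 <= n2)%N, l n2 < (a + D2)%N%:Z & st n2 D2 e2].
    have [N] : exists N : nat, l n1 < (a + D1)%N%:Z + N%:Z.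
      by exists (`|(a + D1)%N%:Z - l n1|.+1); lia.
    elim: N n1 D1 e1 le1 h1 => [|N IH] n1 D1 e1 le1 h1 ltN.
      by exists n1, D1, e1; split=> //; lia.
    have [lt|ge] := ltP (l n1) (a + D1)%N%:Z; first by exists n1, D1, e1.
    have [D' [e' [h' DE']]] := step_any _ _ _ le1 h1.
    rewrite max_l // in DE'.
    by apply: (IH n1.+1 D' e') => //; [exact: leqW|rewrite lS; lia].
  apply: (@linear_growth_geom _ _ a n2 D2 e2 mu (fun=> 0)) => //; try by case: h2.
    exact: ev_expoly0.
  move=> k e e0 hk; rewrite addr0 mulnS addnCA.
  apply: step_gt => //; first by rewrite (leq_trans le2) ?leq_addr.
  rewrite lD; have : (A * k <= a * k)%N by rewrite leq_mul2r ltnW ?orbT.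
  by move: lt2; lia.
(* equal slopes: compare the dimensions one step later *)
have [D2 [e2 [h2 DE2]]] := step_any _ _ _ le1 h1.
have : l n1.+1 <= (a + D2)%N%:Z by rewrite lS -eqA PoszD DE2 addrC lerD2l le_max lexx.
have le2 : (n0 <= n1.+1)%N by apply: leqW.
move: h2 DE2 => + _; move: (n1.+1) le2 => n2 le2 h2.
have leD k : (n0 <= n2 + k)%N by rewrite (leq_trans le2) ?leq_addr.
rewrite le_eqVlt => /predU1P[eq2|lt2].
  apply: (@linear_growth_geom _ _ a n2 D2 e2 mu y) => //; try by case: h2.
  move=> k e e0 hk; rewrite mulnS addnCA.
  by apply: step_eq => //; rewrite lD eq2 -eqA; lia.
apply: (@linear_growth_geom _ _ a n2 D2 e2 mu (fun=> 0)) => //; try by case: h2.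
  exact: ev_expoly0.
move=> k e e0 hk; rewrite addr0 mulnS addnCA.
by apply: step_gt => //; rewrite lD -eqA; lia.
Qed.

(** * Counting words in an order ideal *)

Definition exps_le := higman_le (fun m n : nat => (m <= n)%N).

Lemma exps_le_trans a b d : exps_le a b -> exps_le b d -> exps_le a d.
Proof. by apply: higman_trans => x y z; apply: leq_trans. Qed.

Lemma wqo_exps_le : wqo exps_le.
Proof. by apply: higman wqo_leq => x y z; apply: leq_trans. Qed.

Fixpoint exps_of_degree (c i : nat) : seq (seq nat) :=
  if c is c'.+1 then
    flatten [seq [seq a :: b | b <- exps_of_degree c' (i - a)] | a <- iota 0 i.+1]
  else if i is 0 then [:: [::]] else [::].

Lemma sum_exps_of_degree c i (G : seq nat -> nat) :
  (\sum_(b <- exps_of_degree c.+1 i) G b =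
   \sum_(0 <= a < i.+1) \sum_(b <- exps_of_degree c (i - a)) G (a :: b))%N.
Proof.
rewrite -[exps_of_degree _ _]/(flatten [seq _ | a <- index_iota 0 i.+1]).
rewrite big_flatten big_map; apply: eq_bigr => a _.
by rewrite big_map.
Qed.

(** A box is a product of one-point sets [{a}], encoded as [(false, a)], and of
    rays [{a, a + 1, ...}], encoded as [(true, a)]. *)
Definition box := seq (bool * nat).

Definition corner (x : box) : seq nat := unzip2 x.

Fixpoint box_series (x : box) : nat -> nat :=
  if x is (b, a) :: x' then
    cauchy_prod (if b then fun i => (a <= i)%N : nat else fun i => i == a :
        nat) (box_series x')
  else fun i => i == 0%N.

Lemma box_series_has_pole x : has_pole (box_series x) (count fst x) 1.
Proof.
elim: x => [|[b a] x IH] /=; first exact: has_pole_monomial.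
by rewrite -[1]mulr1; apply: has_pole_cauchy_prod => //; case: b;
    [apply: has_pole_step|apply: has_pole_monomial].
Qed.

Lemma sum_cauchy_prod (l : seq box) i (g : nat -> nat) (G : box -> nat) :
  (\sum_(j < i.+1) g j * \sum_(x <- l) box_series x (i - j) * G x =
   \sum_(x <- l) cauchy_prod g (box_series x) i * G x)%N.
Proof.
under [LHS]eq_bigr do rewrite big_distrr.
rewrite exchange_big; apply: eq_bigr => x _.
by rewrite /cauchy_prod big_distrl; apply: eq_bigr => j _; rewrite /= mulnA.
Qed.

(** If infinitely many values of the first exponent changed the residual ideal,
    then elements that witness the changes would form a bad sequence. *)
Lemma residual_stable (W : Type) (r : W -> W -> Prop) (r_wqo : wqo r)
    (E : seq nat -> set W) :
  (forall b b' w w', exps_le b b' -> r w w' -> E b' w' -> E b w) ->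
  exists a0, forall a, (a0 <= a)%N -> forall b, E (a :: b) = E (a0 :: b).
Proof.
move=> E_down; apply: contrapT => /forallNP unstable.
have next a0 : exists x : nat * (seq nat * W),
    (a0 < x.1)%N /\ E (a0 :: x.2.1) x.2.2 /\ ~ E (x.1 :: x.2.1) x.2.2.
  have /existsNP[a] := unstable a0; rewrite not_implyE => -[le /existsNP[b ne]].
  have sub : E (a :: b) `<=` E (a0 :: b).
    move=> w; have [i [j [ij rij]]] := r_wqo (fun=> w).
    apply: E_down => //; apply: higman_cons => //; exact: higman_refl.
  apply: contrapT => none; apply: ne; rewrite eqEsubset; split=> // w Ew.
  apply: contrapT => nEw; apply: none; exists (a, (b, w)); split=> //=.
  rewrite ltn_neqAle le andbT; apply/eqP => eq_a; by rewrite -eq_a in nEw.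
have [x0 _] := next 0%N.
have [f [_ _ fP]] := @iter_choice (nat * (seq nat * W)) (fun=> True)
   (fun x y => (x.1 < y.1)%N /\ E (x.1 :: y.2.1) y.2.2 /\ ~ E (y.1 :: y.2.1) y.2.2)
   x0 I (fun x _ => let: ex_intro y yP := next x.1 in ex_intro _ y (conj I yP)).
have f_incr i j : (i < j)%N -> ((f i).1 < (f j).1)%N.
  by apply: (@increasing_steps (fst \o f)) => n; case: (fP n).
have [i [j [ij [rij sij]]]] := wqo_prod exps_le_trans wqo_exps_le r_wqo (fun n =>
    (f n.+1).2).
have [_ [_]] := fP i; apply.
have [_ [Ej _]] := fP j; apply: E_down sij Ej; apply: higman_cons => //.
by move: ij; rewrite leq_eqVlt => /predU1P[->//|/f_incr/ltnW].
Qed.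

Lemma letter_decomp (W : Type) (r : W -> W -> Prop) (r_wqo : wqo r) c :
  forall E : seq nat -> set W,
  (forall b b' w w', exps_le b b' -> r w w' -> E b' w' -> E b w) ->
  exists l : seq box, (forall x, x \in l -> size x = c) /\
    forall (F : set W -> nat) i,
      (\sum_(b <- exps_of_degree c i) F (E b) =
          \sum_(x <- l) box_series x i * F (E (corner x)))%N.
Proof.
elim: c => [|c IH] E E_down.
  exists [:: [::]]; split; first by move=> x; rewrite inE => /eqP ->.
  by move=> F [|i]; rewrite /= !(big_cons, big_nil) /= ?mul1n.
have [a0 a0P] := residual_stable r_wqo E_down.
have /choice[l lP] a : exists l : seq box, (forall x, x \in l -> size x = c) /\
    forall (F : set W -> nat) i, (\sum_(b <- exps_of_degree c i) F (E (a :: b)) =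
      \sum_(x <- l) box_series x i * F (E (a :: corner x)))%N.
  apply: (IH (fun b => E (a :: b))) => b b' w w' bb'; apply: E_down.
  exact: higman_cons.
exists (flatten [seq [seq (false, a) :: x | x <- l a] | a <- index_iota 0 a0]
        ++ [seq (true, a0) :: x | x <- l a0]); split.
  move=> x; rewrite mem_cat => /orP[/flattenP[_ /mapP[a _ ->]]|] /mapP[y yl ->] /=.
    by rewrite (lP a).1.
  by rewrite (lP a0).1.
move=> F i; rewrite sum_exps_of_degree [RHS]big_cat big_flatten !big_map.
under [X in _ = (X + _)%N]eq_bigr do rewrite big_map /=.
transitivity (\sum_(0 <= j < i.+1) (\sum_(0 <= a < a0) (j == a) *
    (\sum_(x <- l a) box_series x (i - j) * F (E (a :: corner x))) +
    (a0 <= j) * \sum_(x <- l a0) box_series x (i - j) * F (E (a0 :: corner x))))%N.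
  apply: eq_bigr => j _.
  have [le|lt] := leqP a0 j.
    rewrite mul1n [X in _ = (X + _)%N]big1_seq ?add0n => [|a].
      by rewrite -(lP a0).2; apply: eq_bigr => b _; rewrite a0P.
    by rewrite mem_index_iota => /andP[_ lt]; case: eqP lt => [<-|]//;
        rewrite ltnNge le.
  rewrite mul0n addn0 (bigD1_seq j) ?iota_uniq ?mem_index_iota //= eqxx mul1n.
  rewrite [X in _ = (_ + X)%N]big1 ?addn0 ?(lP j).2 // => a; rewrite eq_sym =>
      /negPf -> //.
rewrite big_split /= exchange_big /=; congr (_ + _)%N.
  by apply: eq_bigr => a _; rewrite big_mkord;
    apply: (sum_cauchy_prod (l a) i (fun j => j == a : nat) (fun x =>
        F (E (a :: corner x)))).
rewrite big_mkord.
exact: (sum_cauchy_prod (l a0) i (fun j => (a0 <= j)%N : nat) (fun x =>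
    F (E (a0 :: corner x)))).
Qed.

Definition letter := (bool * seq nat)%type.

Definition letter_le (p q : letter) := p.1 = q.1 /\ exps_le p.2 q.2.

Lemma letter_le_refl p : letter_le p p.
Proof. by split=> //; apply: higman_refl. Qed.

Lemma letter_le_trans p q s : letter_le p q -> letter_le q s -> letter_le p s.
Proof. by rewrite /letter_le => -[-> pq] [-> qs]; split=> //;
    apply: exps_le_trans qs. Qed.

Definition word_le := higman_le letter_le.

Lemma word_le_trans u v w : word_le u v -> word_le v w -> word_le u w.
Proof. exact: (higman_trans letter_le_trans). Qed.

Lemma word_le_refl u : word_le u u.
Proof. exact: (higman_refl letter_le_refl). Qed.

Lemma wqo_word_le : wqo word_le.
Proof.
apply: (higman letter_le_trans); apply: wqo_prod wqo_bool wqo_exps_le.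
by move=> x y z -> ->.
Qed.

(** Words are enumerated by their first letters; this is the recursion on which
    [linear_growth_words] rests. *)
Fixpoint words (c n d j : nat) : seq (seq letter) :=
  if n is n'.+1 then
    flatten [seq [seq (false, b) :: w | b <- exps_of_degree c i, w <- words c n' d (j - i)]
            | i <- iota 0 j.+1] ++
    if d is d'.+1 then
      flatten [seq [seq (true, b) :: w | b <- exps_of_degree c i, w <- words c n' d' (j - i)]
              | i <- iota 0 j.+1]
    else [::]
  else if (d == 0%N) && (j == 0%N) then [:: [::]] else [::].

Definition count_words c (S : set (seq letter)) n d j :=
  count (fun w => `[< S w >]) (words c n d j).

Definition residual (S : set (seq letter)) f b : set (seq letter) :=
  [set w | S ((f, b) :: w)].

Lemma count_block c (S : set (seq letter)) f (ws : nat -> seq (seq letter)) j :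
  count (fun w => `[< S w >]) (flatten [seq [seq (f, b) :: w | b <- exps_of_degree c i,
      w <- ws (j - i)%N] | i <- iota 0 j.+1]) =
  (\sum_(i < j.+1) \sum_(b <- exps_of_degree c i)
      count (fun w => `[< residual S f b w >]) (ws (j - i)%N))%N.
Proof.
rewrite count_flatten -map_comp sumnE big_map -[iota 0 _]/(index_iota 0 j.+1).
rewrite big_mkord; apply: eq_bigr => i _ /=.
rewrite count_flatten -map_comp sumnE big_map; apply: eq_bigr => b _ /=.
by rewrite count_map; apply: eq_count => w.
Qed.

Lemma count_wordsS c S n d j : count_words c S n.+1 d j =
  (\sum_(i < j.+1) \sum_(b <- exps_of_degree c i) count_words c (residual S false b) n d (j - i) +
   if d is d'.+1 then
     \sum_(i < j.+1) \sum_(b <- exps_of_degree c i) count_words c (residual S true b) n d' (j - i)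
   else 0)%N.
Proof.
by rewrite /count_words /= count_cat; case: d => [|d]; rewrite !(count_block c S).
Qed.

Lemma linear_growth0 c : linear_growth c (fun _ _ => 0%N).
Proof. by split=> [n|]; left => //; exists 0%N. Qed.

Lemma linear_growth_sum c (I : eqType) (l : seq I) (P : pred I) X :
  (forall x, x \in l -> P x -> linear_growth c (X x)) ->
  linear_growth c (fun n j => \sum_(x <- l | P x) X x n j)%N.
Proof.
elim: l => [|x l IH] gX.
  by apply: linear_growth_ext (linear_growth0 c) => n j; rewrite big_nil.
have {}IH := IH (fun y yl => gX y (mem_behead (yl : y \in behead (x :: l)))).
have [Px|nPx] := boolP (P x); last first.
  by apply: linear_growth_ext IH => n j; rewrite big_cons (negPf nPx).
have gx := gX x (mem_head _ _) Px.
by apply: linear_growth_ext (linear_growth_add gx IH) => n j; rewrite big_cons Px.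
Qed.

Lemma zero_or_pole_le_box_series c (l : seq box) (P : pred box) :
  (forall x, x \in l -> size x = c) ->
  zero_or_pole_le c (fun i => \sum_(x <- l | P x) box_series x i)%N.
Proof.
elim: l => [|x l IH] l_c; first by left=> j; rewrite big_nil.
have {}IH := IH (fun y yl => l_c y (mem_behead (yl : y \in behead (x :: l)))).
have sum_ext f i : (\sum_(y <- x :: l | P y) f y i =
    (if P x then f x i else 0) + \sum_(y <- l | P y) f y i)%N.
  by rewrite big_cons; case: (P x).
have [Px|nPx] := boolP (P x); last first.
  have sumE i : (\sum_(y <- l | P y) box_series y i =
      \sum_(y <- x :: l | P y) box_series y i)%N.
    by rewrite big_cons (negPf nPx).
  case: IH => [f0|[a [mu [ac m0 h]]]]; first by left=> j; rewrite -sumE.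
  by right; exists a, mu; split=> //; apply: has_pole_ext h.
right.
have sumE i : (box_series x i + \sum_(y <- l | P y) box_series y i =
    \sum_(y <- x :: l | P y) box_series y i)%N by rewrite big_cons Px.
have cc : (count fst x <= c)%N by rewrite -(l_c x (mem_head _ _)) count_size.
case: IH => [f0|[a [mu [ac m0 h]]]].
  exists (count fst x), 1%N; split=> //.
  by apply: has_pole_ext (box_series_has_pole x) => j; rewrite -sumE f0 addn0.
have [//|e [e0 he]] := has_pole_add_max ltr01 _ (box_series_has_pole x) h.
exists (maxn (count fst x) a), `|e|%N; split.
- by rewrite geq_max cc.
- by rewrite absz_gt0 gt_eqF.
- by rewrite gez0_abs ?ltW //; apply: has_pole_ext he.
Qed.

Lemma residual_down S f : downset word_le S -> forall b b' w w',
  exps_le b b' -> word_le w w' -> residual S f b' w' -> residual S f b w.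
Proof. by move=> dS b b' w w' bb' ww'; apply: dS; apply: higman_cons. Qed.

Lemma residual_downset S f b : downset word_le S -> downset word_le (residual S f b).
Proof. by move=> dS w w' ww'; apply: (residual_down dS) => //; apply: higman_refl. Qed.

Lemma residual_sub S f b : downset word_le S -> residual S f b `<=` S.
Proof. by move=> dS w; apply: dS; constructor; apply: word_le_refl. Qed.

Lemma cauchy_prod_suml (l : seq box) (P : pred box) (f : box -> nat -> nat) g j :
  (cauchy_prod (fun i => \sum_(x <- l | P x) f x i) g j =
      \sum_(x <- l | P x) cauchy_prod (f x) g j)%N.
Proof.
by rewrite /cauchy_prod exchange_big; apply: eq_bigr => i _; rewrite big_distrl.
Qed.

(** Reading the first letter of a word of an ideal [S] leads to a smaller ideal,
    to an ideal with fewer marks left, or back to [S]; the series of the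
    letters of the last kind is the coefficient of a linear recursion. *)
Lemma linear_growth_words c d S : downset word_le S -> linear_growth c (fun n j =>
    count_words c S n d j).
Proof.
elim/ltn_ind: d S => d IHd; apply: downset_ind wqo_word_le _ _ => S dS IHS.
have decomp f := letter_decomp wqo_word_le c (residual_down dS (f := f)).
have [l [l_c lP]] := decomp false.
have [l' [l'_c l'P]] := decomp true.
pose loop x := `[< residual S false (corner x) = S >].
pose Y n j := (\sum_(x <- l | ~~ loop x)
    cauchy_prod (box_series x) (count_words c (residual S false (corner x)) n d) j +
  if d is d'.+1 then \sum_(x <- l')
    cauchy_prod (box_series x) (count_words c (residual S true (corner x)) n d') j else 0)%N.
apply: (@linear_growth_rec c (fun i => \sum_(x <- l | loop x) box_series x i)%N _ Y).
- exact: zero_or_pole_le_box_series.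
- apply: linear_growth_add.
    apply: linear_growth_sum => x _ /asboolPn ne.
    apply: (linear_growth_cauchy_prod (X := fun n =>
        count_words c _ n d) (box_series_has_pole x)).
    by apply: IHS => //; [apply: residual_downset|apply: residual_sub].
  case: d {IHS Y} IHd => [|d] IHd; first exact: linear_growth0.
  apply: (linear_growth_sum (P := predT)) => x _ _.
  apply: (linear_growth_cauchy_prod (X := fun n =>
      count_words c _ n d) (box_series_has_pole x)).
  by apply: IHd => //; apply: residual_downset.
- have [SS|nSS] := pselect (S [::] /\ d = 0%N).
    right; exists 0%N, 1; split=> //; apply: has_pole_ext (has_pole_monomial 0) => j.
    rewrite /count_words /= SS.2 eqxx /=; case: eqP => //= _.
    by rewrite asboolT //; case: SS.
  left=> j; rewrite /count_words /=; case: eqP => //= d0; case: eqP => //= _.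
  by rewrite asboolF // => S0; apply: nSS.
move=> n j; rewrite count_wordsS /Y addnA.
have block f (l1 : seq box) d1 : (forall (F : set (seq letter) -> nat) i,
      \sum_(b <- exps_of_degree c i) F (residual S f b) =
      \sum_(x <- l1) box_series x i * F (residual S f (corner x)))%N ->
    (\sum_(i < j.+1) \sum_(b <- exps_of_degree c i) count_words c (residual S f b) n d1 (j - i) =
     \sum_(x <- l1) cauchy_prod (box_series x) (count_words c (residual S f (corner x)) n d1) j)%N.
  move=> l1P; rewrite exchange_big; apply: eq_bigr => i _.
  exact: (l1P (fun T => count_words c T n d1 (j - i)%N)).
congr (_ + _)%N; last by case: d {IHd IHS Y} => // d; apply: block.
rewrite (block _ l) // (bigID loop) /=; congr (_ + _)%N.
by rewrite cauchy_prod_suml; apply: eq_bigr => x /asboolP ->.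
Qed.

(** * Increasing maps and words *)

Lemma mor_lt m n (e : mor OI m n) (i j : 'I_m) : (i < j)%N -> (e i < e j)%N.
Proof. by move: (valP e) => /= /forallP/(_ i)/forallP/(_ j)/implyP. Qed.

Lemma mor_inj m n (e : mor OI m n) : injective e.
Proof.
move=> i j eij; apply: val_inj; case: (ltngtP i j) => // /(mor_lt e);
by rewrite eij ltnn.
Qed.

Lemma mor_ext C m n (e e' : mor C m n) : e =1 e' -> e = e'.
Proof. by move=> ee; apply: val_inj; apply/ffunP. Qed.

Lemma mk_mor m n (f : 'I_m -> 'I_n) : (forall i j : 'I_m, (i < j)%N -> (f i < f j)%N) ->
  exists e : mor OI m n, e =1 f.
Proof.
move=> f_lt; have fP : is_mor OI [ffun i => f i].
  by apply/forallP => i; apply/forallP => j; rewrite !ffunE; apply/implyP/f_lt.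
by exists (Sub [ffun i => f i] fP) => i; rewrite /mor_fun SubK ffunE.
Qed.

Lemma mor_compE C m n p (f : mor C n p) (e : mor C m n) i : mor_comp f e i = f (e i).
Proof. by rewrite /mor_comp /mor_fun /= ffunE. Qed.

Lemma mor_of_set n d (A : {set 'I_n}) : #|A| = d ->
  exists e : mor OI d n, forall j, (j \in codom e) = (j \in A).
Proof.
move=> <-; have [|e eE] := @mk_mor #|A| n (fun i => enum_val i).
  move=> i j ij; pose x0 := enum_val i; rewrite !(enum_val_nth x0).
  have sA : sorted (fun x y : 'I_n => (x < y)%N) (enum A).
    rewrite {1}/enum_mem -enumT; apply: sorted_filter; first by move=> ? ? ?;
        apply: ltn_trans.
    by rewrite -(@sorted_map _ _ val ltn) val_enum_ord iota_ltn_sorted.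
  apply: (sorted_ltn_nth _ x0 sA) ij; first by move=> ? ? ?; apply: ltn_trans.
    by rewrite inE -cardE.
  by rewrite inE -cardE.
exists e => j; apply/codomP/idP => [[i ->]|jA]; first by rewrite eE enum_valP.
by exists (enum_rank_in jA j); rewrite eE enum_rankK_in.
Qed.

(** Both maps list the elements of their common image in increasing order. *)
Lemma mor_codom_inj n d (e e' : mor OI d n) : codom e =i codom e' -> e = e'.
Proof.
move=> ee; apply: mor_ext => i.
have sorted_codom (f : mor OI d n) : sorted (fun x y : 'I_n => (x < y)%N) (codom f).
  rewrite /codom /image_mem sorted_map.
  apply: (@sub_sorted _ (fun x y : 'I_d => (x < y)%N)); first by move=> x y /(mor_lt f).
  by rewrite -(@sorted_map _ _ val ltn) enumT -enumT val_enum_ord iota_ltn_sorted.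
have : codom e = codom e'.
  apply: (irr_sorted_eq _ _ (sorted_codom e) (sorted_codom e') ee) => //.
    by move=> ? ? ?; apply: ltn_trans.
  by move=> x; apply: ltnn.
by move/eq_in_map; apply; rewrite mem_enum.
Qed.

Section Words.
Variable c : nat.

Definition mexp n (m : multinom (nvars c n)) (i : 'I_c) (j : 'I_n) : nat :=
  m (enum_rank (i, j)).

Lemma mexpP n (m m' : multinom (nvars c n)) :
  (forall i j, mexp m i j = mexp m' i j) -> m = m'.
Proof.
move=> mm; apply/mnmP => k; rewrite -(enum_valK k).
by case: (enum_val k) => i j; apply: mm.
Qed.

Lemma mdeg_mexp n (m : multinom (nvars c n)) :
  mdeg m = (\sum_(j < n) \sum_(i < c) mexp m i j)%N.
Proof.
rewrite mdegE exchange_big pair_big /= /mexp.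
rewrite (reindex (fun p : 'I_c * 'I_n => enum_rank p)) /=.
  by apply: eq_bigr => -[i j] _.
by apply: onW_bij; exists enum_val => k; rewrite ?enum_rankK ?enum_valK.
Qed.

Definition mk_mnm n (f : 'I_c -> 'I_n -> nat) : multinom (nvars c n) :=
  Multinom [tuple f (enum_val k).1 (enum_val k).2 | k < nvars c n].

Lemma mk_mnmE n f i j : mexp (@mk_mnm n f) i j = f i j.
Proof. by rewrite /mexp /mk_mnm mnmE enum_rankK. Qed.

(** The action of a morphism on the exponents of monomials. *)
Definition pushk m n (e : mor OI m n) (k : 'I_(nvars c m)) : 'I_(nvars c n) :=
  enum_rank ((enum_val k).1, e (enum_val k).2).

Definition pushm m n (e : mor OI m n) (a : multinom (nvars c m)) :
    multinom (nvars c n) :=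
  \big[@mnm_add _/@mnm0 _]_k mnm_muln (mnm1 (pushk e k)) (a k).

Lemma pushk_inj m n (e : mor OI m n) : injective (pushk e).
Proof.
move=> k k' /enum_rank_inj[e1 /mor_inj e2]; apply: enum_val_inj.
by case: (enum_val k) (enum_val k') e1 e2 => i j [i' j'] /= -> ->.
Qed.

Lemma pushmE m n (e : mor OI m n) a k' :
  pushm e a k' = (\sum_k (pushk e k == k') * a k)%N.
Proof.
by rewrite /pushm mnm_sumE; apply: eq_bigr => k _; rewrite mulmnE mnm1E.
Qed.

Lemma pushm_in m n (e : mor OI m n) a i j : mexp (pushm e a) i (e j) = mexp a i j.
Proof.
rewrite /mexp pushmE (bigD1 (enum_rank (i, j))) //= big1 => [|k ne].
  by rewrite /pushk enum_rankK eqxx mul1n addn0.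
case: eqP => //; have <- : pushk e (enum_rank (i, j)) = enum_rank (i, e j).
  by rewrite /pushk enum_rankK.
by move/pushk_inj/eqP; rewrite (negPf ne).
Qed.

Lemma pushm_out m n (e : mor OI m n) a i j : j \notin codom e ->
  mexp (pushm e a) i j = 0%N.
Proof.
move=> nj; rewrite /mexp pushmE big1 // => k _; case: eqP => // /enum_rank_inj[_ ej].
by case/negP: nj; rewrite -ej codom_f.
Qed.

Lemma mdeg_pushm m n (e : mor OI m n) a : mdeg (pushm e a) = mdeg a.
Proof.
rewrite /pushm mdeg_sum mdegE; apply: eq_bigr => k _.
by rewrite mdegMn mdeg1 mul1n.
Qed.

Lemma push_mpolyX (K : fieldType) m n (e : mor OI m n) a :
  push e (mpolyX K a) = mpolyX K (pushm e a).
Proof.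
rewrite /push mmapX /mmap1 /pushm (big_morph _ (@mpolyXD _ K) (@mpolyX0 _ K)).
by apply: eq_bigr => k _; rewrite -mpolyXn.
Qed.

(** The word of the element [x^a * e] of a free module of rank one generated in
    degree [d]: the marks are the image of [e]. *)
Definition enc d n (e : mor OI d n) (a : multinom (nvars c n)) : seq letter :=
  [seq (j \in codom e, [seq mexp a i j | i <- enum 'I_c]) | j <- enum 'I_n].

Definition no_letter : letter := (false, [::]).

Lemma size_enc d n (e : mor OI d n) a : size (enc e a) = n.
Proof. by rewrite size_map size_enum_ord. Qed.

Lemma nth_enc d n (e : mor OI d n) a (j : 'I_n) :
  nth no_letter (enc e a) j = (j \in codom e, [seq mexp a i j | i <- enum 'I_c]).
Proof. by rewrite (nth_map j) ?size_enum_ord // nth_ord_enum. Qed.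

Lemma nth_exps n (a : multinom (nvars c n)) (i : 'I_c) j :
  nth 0%N [seq mexp a i j | i <- enum 'I_c] i = mexp a i j.
Proof. by rewrite (nth_map i) ?size_enum_ord // nth_ord_enum. Qed.

Lemma size_exps n (a : multinom (nvars c n)) j :
  size [seq mexp a i j | i <- enum 'I_c] = c.
Proof. by rewrite size_map size_enum_ord. Qed.

Lemma enc_inj d n (e e' : mor OI d n) a a' : enc e a = enc e' a' -> e = e' /\ a = a'.
Proof.
move=> eq_enc; have nthE j : nth no_letter (enc e a) j =
    nth no_letter (enc e' a') j by rewrite eq_enc.
split.
  by apply: mor_codom_inj => j; move: (nthE j); rewrite !nth_enc => -[].
apply: mexpP => i j; move: (nthE j); rewrite !nth_enc => -[_ eq_j].
by rewrite -!nth_exps eq_j.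
Qed.

(** The embedding of words gives the morphism, and the surplus of exponents gives
    the cofactor. All marks of the larger word are hit, since both words have
    [d] of them. *)
Lemma word_le_enc d n n' (e : mor OI d n) (e' : mor OI d n') a a' :
  word_le (enc e a) (enc e' a') ->
  exists (f : mor OI n n') (b : multinom (nvars c n')),
    e' = mor_comp f e /\ a' = mnm_add b (pushm f a).
Proof.
move/(higman_index no_letter); rewrite !size_enc => -[g [g_incr gP]].
have [f fE] := @mk_mor n n' (fun j => Ordinal (gP j (ltn_ord j)).1)
  (fun i j ij => g_incr _ _ ij).
have lr_f (j : 'I_n) :
    letter_le (nth no_letter (enc e a) j) (nth no_letter (enc e' a') (f j)).
  by rewrite fE /=; case: (gP j (ltn_ord j)).
have codomE j : (j \in codom e) = (f j \in codom e').
  by have [] := lr_f j; rewrite !nth_enc.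
have exp_le i j : (mexp a i j <= mexp a' i (f j))%N.
  have [_] := lr_f j; rewrite !nth_enc /= => /(higman_pointwise 0%N).
  by rewrite !size_exps => /(_ erefl i (ltn_ord i)); rewrite !nth_exps.
exists f, (mnm_sub a' (pushm f a)); split; last first.
  apply/esym/submK/mnm_lepP => k; rewrite -(enum_valK k); case: (enum_val k) => i j.
  have [/codomP[j' ->]|nj] := boolP (j \in codom f).
    by rewrite -/(mexp _ _ _) pushm_in; apply: exp_le.
  by rewrite -/(mexp _ _ _) pushm_out.
apply/esym/mor_codom_inj; apply/subset_cardP.
  by rewrite !card_codom //; apply: mor_inj.
apply/fintype.subsetP => j /codomP[i ->].
by rewrite mor_compE -codomE codom_f.
Qed.

Lemma mem_exps_of_degree k i (b : seq nat) :
  (b \in exps_of_degree k i) = (size b == k) && (sumn b == i).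
Proof.
elim: k i b => [|k IH] i b.
  by case: i b => [|i] [|x b] //=; rewrite ?inE ?andbF.
rewrite -[exps_of_degree _ _]/(flatten [seq _ | a <- index_iota 0 i.+1]).
apply/flatten_mapP/idP => [[a]|].
  rewrite mem_index_iota /= => ai /mapP[b']; rewrite IH => /andP[/eqP sb /eqP sm] ->.
  by rewrite /= sb eqxx sm subnKC ?eqxx.
case: b => [|a b] // /andP[/eqP[sb] /eqP/= sm]; exists a.
  by rewrite mem_index_iota /= ltnS -sm leq_addr.
by apply/mapP; exists b => //; rewrite IH sb -sm addnC addnK !eqxx.
Qed.

Lemma uniq_flatten_map (I T : eqType) (r : seq I) (F : I -> seq T) (key : T -> I) :
  uniq r -> (forall i, uniq (F i)) -> (forall i x, x \in F i -> key x = i) ->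
  uniq (flatten [seq F i | i <- r]).
Proof.
move=> + uF Fk; elim: r => //= i r IH /andP[ir ur]; rewrite cat_uniq uF IH // andbT.
apply/hasPn => x /flatten_mapP[i' i'r xi']; apply/negP => xi.
by rewrite -(Fk _ _ xi) (Fk _ _ xi') i'r in ir.
Qed.

Lemma uniq_exps_of_degree k i : uniq (exps_of_degree k i).
Proof.
elim: k i => [|k IH] i; first by case: i.
apply: (@uniq_flatten_map _ _ _ _ (head 0%N)); first exact: iota_uniq.
  by move=> a; rewrite map_inj_uniq ?IH // => x y [].
by move=> a x /mapP[y _ ->].
Qed.

Definition wdeg (w : seq letter) : nat := sumn [seq sumn p.2 | p <- w].

Definition is_word n d j (w : seq letter) : bool :=
  [&& size w == n, all (fun p => size p.2 == c) w, count fst w == d & wdeg w == j].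

Definition block (f : bool) (ws : nat -> seq (seq letter)) (j : nat) :=
  flatten [seq [seq (f, b) :: w | b <- exps_of_degree c i, w <- ws (j - i)%N]
          | i <- index_iota 0 j.+1].

Lemma mem_block f ws j w : (w \in block f ws j) = if w is p :: w' then
  [&& p.1 == f, size p.2 == c, (sumn p.2 <= j)%N & w' \in ws (j - sumn p.2)%N] else false.
Proof.
apply/flatten_mapP/idP => [[i]|].
  rewrite mem_index_iota ltnS => /= ij /allpairsPdep[b [w' [+ w'w ->]]].
  by rewrite mem_exps_of_degree => /andP[-> /eqP bi] /=; rewrite eqxx bi ij.
case: w => // -[f' b] w /= /and4P[/eqP-> bc bj ww]; exists (sumn b).
  by rewrite mem_index_iota ltnS bj.
by apply/allpairsPdep; exists b, w; rewrite mem_exps_of_degree bc eqxx.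
Qed.

Lemma uniq_block f ws j : (forall i, uniq (ws i)) -> uniq (block f ws j).
Proof.
move=> u; pose hd (w : seq letter) := (head no_letter w).2.
apply: (@uniq_flatten_map _ _ _ _ (fun w => sumn (hd w))); first exact: iota_uniq.
  move=> i; apply: (@uniq_flatten_map _ _ _ _ hd); first exact: uniq_exps_of_degree.
    by move=> b; rewrite map_inj_uniq // => x y [].
  by move=> b w /mapP[w' _ ->].
by move=> i w /allpairsPdep[b [w' [+ _ ->]]]; rewrite mem_exps_of_degree =>
    /andP[_ /eqP].
Qed.

Lemma wordsS n d j : words c n.+1 d j = block false (words c n d) j ++
  if d is d'.+1 then block true (words c n d') j else [::].
Proof. by case: d. Qed.

Lemma mem_words n d j w : (w \in words c n d j) = is_word n d j w.
Proof.
elim: n d j w => [|n IH] d j w.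
  case: w => [|p w]; last by rewrite /=; case: ifP.
  by rewrite /is_word /= [in RHS]eq_sym [0%N == j]eq_sym; case: ifP; rewrite ?inE.
rewrite wordsS mem_cat mem_block; case: w => [|[f b] w].
  by case: d => // d; rewrite mem_block.
have sum_eq : (sumn b <= j)%N && (wdeg w == j - sumn b)%N = (sumn b + wdeg w == j)%N.
  by apply/idP/idP; rewrite /wdeg; lia.
have -> : ((f, b) :: w \in (if d is d'.+1 then block true (words c n d') j else [::]))
    = [&& f, size b == c, (sumn b <= j)%N, (0 < d)%N & is_word n d.-1 (j - sumn b)%N w].
  case: d => [|d]; first by rewrite !andbF.
  by rewrite mem_block /= IH; case: f.
rewrite IH /is_word /= eqSS /wdeg /= -/(wdeg w) -sum_eq; case: f => /=.
  case: d => [|d] /=; first by rewrite !andbF.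
  by rewrite add1n eqSS; do !bool_congr.
by rewrite orbF add0n; do !bool_congr.
Qed.

Lemma uniq_words n d j : uniq (words c n d j).
Proof.
elim: n d j => [|n IH] d j; first by rewrite /=; case: ifP.
rewrite wordsS cat_uniq uniq_block //=; case: d => [|d] //=.
rewrite uniq_block // andbT; apply/hasPn => w; rewrite !mem_block.
by case: w => // -[[] b] w.
Qed.

Lemma enc_words d n (e : mor OI d n) a : enc e a \in words c n d (mdeg a).
Proof.
rewrite mem_words /is_word size_enc eqxx /=; apply/and3P; split.
- by apply/allP => _ /mapP[j _ ->]; rewrite size_exps.
- rewrite count_map (enumT 'I_n) -[X in _ == X](card_ord d) -(card_codom (@mor_inj _ _ e)).
  by rewrite cardE /enum_mem size_filter; apply/eqP/eq_count.
- rewrite /wdeg /enc -map_comp sumnE big_map mdeg_mexp big_enum /=;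
    apply/eqP/eq_bigr => j _.
  by rewrite sumnE big_map big_enum.
Qed.

Lemma words_enc d n j w : w \in words c n d j ->
  exists (e : mor OI d n) a, mdeg a = j /\ w = enc e a.
Proof.
move=> w_in; have := w_in; rewrite mem_words => /and4P[/eqP sw /allP cw /eqP dw _].
pose A : {set 'I_n} := finset (fun k : 'I_n => (nth no_letter w k).1).
have wE : w = [seq nth no_letter w j | j : 'I_n <- enum 'I_n].
  by rewrite -{1}(mkseq_nth no_letter w) sw /mkseq -val_enum_ord -map_comp.
have cardA : #|A| = d.
  rewrite -dw wE count_map (enumT 'I_n) cardE /enum_mem size_filter.
  by apply: eq_count => k; rewrite -[LHS]/(k \in A) finset.in_set.
have [e eA] := mor_of_set cardA.
pose a := mk_mnm (fun i (j : 'I_n) => nth 0%N (nth no_letter w j).2 i).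
have enc_w : w = enc e a.
  rewrite {1}wE; apply: eq_map => k; rewrite eA inE.
  have sk : size (nth no_letter w k).2 = c by apply/eqP/cw/mem_nth; rewrite sw.
  case E: (nth no_letter w k) sk => [f b] /= sk; congr (_, _).
  rewrite -{1}(mkseq_nth 0%N b) sk /mkseq -val_enum_ord -map_comp.
  by apply: eq_map => i; rewrite /= mk_mnmE E.
exists e, a; split=> //.
move: w_in; rewrite enc_w mem_words => /and4P[_ _ _ /eqP <-].
by have := enc_words e a; rewrite mem_words => /and4P[_ _ _ /eqP].
Qed.

End Words.

(** * Dimensions over the ground field *)

Section Span.
Variables (K : fieldType) (r : nat) (N : lmodType (mpoly r K)).
Implicit Types (A B V : set N) (u v : N).

Inductive Kspan A : N -> Prop :=
| Kspan0 : Kspan A 0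
| KspanS (a : K) v u : A v -> Kspan A u -> Kspan A (mpolyC r a *: v + u).

Lemma KspanD A u v : Kspan A u -> Kspan A v -> Kspan A (u + v).
Proof.
move=> Au Av; elim: Au => [|a w u' Aw _ IH]; first by rewrite add0r.
by rewrite -addrA; constructor.
Qed.

Lemma KspanZ A (a : K) v : Kspan A v -> Kspan A (mpolyC r a *: v).
Proof.
elim=> [|b w u Aw _ IH]; first by rewrite scaler0; constructor.
by rewrite scalerDr scalerA -mpolyCM; constructor.
Qed.

Lemma Kspan_in A v : A v -> Kspan A v.
Proof.
move=> Av; rewrite -[v]addr0 -[v]scale1r -(mpolyC1 r K).
by constructor => //; constructor.
Qed.

Lemma Kspan_sum A (J : Type) (s : seq J) (F : J -> N) :
  (forall i, Kspan A (F i)) -> Kspan A (\sum_(i <- s) F i).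
Proof.
move=> AF; elim: s => [|i s IH]; first by rewrite big_nil; constructor.
by rewrite big_cons; apply: KspanD.
Qed.

Lemma Kspan_sub A B : (forall v, A v -> Kspan B v) -> forall v, Kspan A v -> Kspan B v.
Proof.
move=> AB v; elim=> [|a w u Aw _ IH]; first by constructor.
by apply: KspanD IH; apply/KspanZ/AB.
Qed.

Lemma Kspan_mono A B : A `<=` B -> Kspan A `<=` Kspan B.
Proof. by move=> AB v; apply: Kspan_sub => w /AB/Kspan_in. Qed.

Lemma scaleCN (a : K) v : mpolyC r (- a) *: v = - (mpolyC r a *: v).
Proof. by rewrite mpolyCN scaleNr. Qed.

(** The coordinates of a longer basis in a shorter one form a matrix with a
    nonzero row kernel, which is a relation between the vectors of the first. *)
Lemma has_Kdim_leq V d d' : V 0 -> has_Kdim V d -> has_Kdim V d' -> (d' <= d)%N.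
Proof.
move=> V0 [b [Vb bP]] [b' [Vb' b'P]]; rewrite leqNgt; apply/negP => lt.
have /choice[A AP] i : exists a : {ffun 'I_d -> K}, b' i = \sum_j mpolyC r (a j) *: b j.
  by have [a [aP _]] := bP _ (Vb' i); exists a.
pose B := \matrix_(i < d', j < d) A i j.
have : kermx B != 0.
  rewrite -mxrank_eq0 mxrank_ker subn_eq0 -ltnNge.
  exact: leq_ltn_trans (rank_leq_col _) lt.
case/rowV0Pn => x /sub_kermxP xB x_n0.
pose f := [ffun i : 'I_d' => x 0 i].
have sum_f : 0 = \sum_i mpolyC r (f i) *: b' i.
  under eq_bigr => i _ do rewrite AP scaler_sumr.
  rewrite exchange_big big1 // => j _.
  under eq_bigr => i _ do rewrite scalerA -mpolyCM.
  rewrite -scaler_suml -raddf_sum /=.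
  suff -> : \sum_i f i * A i j = 0 by rewrite raddf0 scale0r.
  have /matrixP/(_ 0 j) := xB; rewrite !mxE => xB0; rewrite -[RHS]xB0.
  by apply: eq_bigr => i _; rewrite !mxE ffunE.
have sum_0 : 0 = \sum_i mpolyC r ([ffun=> 0] i) *: b' i.
  by rewrite big1 // => i _; rewrite ffunE mpolyC0 scale0r.
have [a [_ a_uniq]] := b'P _ V0.
have ff : f = [ffun=> 0] by rewrite -(a_uniq _ sum_f) -(a_uniq _ sum_0).
case/eqP: x_n0; apply/rowP => i; have /ffunP/(_ i) := ff.
by rewrite !ffunE mxE.
Qed.

Lemma has_Kdim_uniq V d d' : V 0 -> has_Kdim V d -> has_Kdim V d' -> d = d'.
Proof.
move=> V0 h h'; apply/eqP; rewrite eqn_leq.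
by rewrite (has_Kdim_leq V0 h h') (has_Kdim_leq V0 h' h).
Qed.

Lemma has_Kdim0 A : (forall v, ~ A v) -> has_Kdim (Kspan A) 0.
Proof.
move=> A0; exists (fun=> 0); split=> [[]|v] // Av.
have -> : v = 0 by case: Av => // a w u /A0.
exists [ffun=> 0]; split; first by rewrite big_ord0.
by move=> a _; apply/ffunP => -[].
Qed.

(** A nonzero coefficient of [v] in the difference of two representations would put
    [v] into the span of [A]. *)
Lemma has_KdimS A v d : has_Kdim (Kspan A) d -> ~ Kspan A v ->
  has_Kdim (Kspan (A `|` [set v])) d.+1.
Proof.
move=> [b [Ab bP]] nAv.
pose b' (i : 'I_d.+1) := if unlift ord_max i is Some j then b j else v.
have b'_max : b' ord_max = v by rewrite /b' unlift_none.
have b'_lift j : b' (lift ord_max j) = b j by rewrite /b' liftK.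
have sumE (a : {ffun 'I_d.+1 -> K}) : \sum_i mpolyC r (a i) *: b' i =
    mpolyC r (a ord_max) *: v +
    \sum_j mpolyC r ([ffun j => a (lift ord_max j)] j) *: b j.
  rewrite (bigD1_ord ord_max) //= b'_max; congr (_ + _).
  by apply: eq_bigr => j _; rewrite b'_lift ffunE.
have sumA (a : {ffun 'I_d -> K}) : Kspan A (\sum_j mpolyC r (a j) *: b j).
  by apply: Kspan_sum => j; apply/KspanZ.
exists b'; split=> [i|u].
  rewrite /b'; case: unliftP => [j _|_]; last by apply: Kspan_in; right.
  by apply: Kspan_mono (Ab j) => w; left.
have decomp w : Kspan (A `|` [set v]) w ->
    exists (a : K) w', Kspan A w' /\ w = mpolyC r a *: v + w'.
  elim=> [|a x y Ax _ [a' [w' [Aw' ->]]]].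
    by exists 0, 0; split; [constructor|rewrite mpolyC0 scale0r addr0].
  case: Ax => [Ax|->]; last first.
    by exists (a + a'), w'; rewrite mpolyCD scalerDl addrA.
  by exists a', (mpolyC r a *: x + w'); split; [constructor|rewrite addrCA].
move=> /decomp[a0 [w' [/bP[a [w'E a_uniq]] uE]]].
pose a' : {ffun 'I_d.+1 -> K} := [ffun i : 'I_d.+1 =>
    if unlift ord_max i is Some j then a j else a0].
have a'_max : a' ord_max = a0 by rewrite ffunE unlift_none.
have a'_lift : [ffun j => a' (lift ord_max j)] = a.
  by apply/ffunP => j; rewrite !ffunE liftK.
exists a'; split; first by rewrite sumE a'_max a'_lift uE w'E.
move=> a2; rewrite sumE uE => eq_u.
have eq_max : a2 ord_max = a0.
  apply: contrapT => /eqP; rewrite -subr_eq0 => ne; apply: nAv.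
  have -> : v = mpolyC r (a2 ord_max - a0)^-1 *: (mpolyC r (a2 ord_max - a0) *: v).
    by rewrite scalerA -mpolyCM mulVf // mpolyC1 scale1r.
  apply: KspanZ; rewrite mpolyCB scalerBl.
  have -> : mpolyC r (a2 ord_max) *: v - mpolyC r a0 *: v =
      w' + mpolyC r (-1) *: \sum_j mpolyC r ([ffun j => a2 (lift ord_max j)] j) *: b j.
    rewrite scaleCN mpolyC1 scale1r; apply/eqP; rewrite subr_eq addrAC eq_sym subr_eq.
    by rewrite addrC eq_u.
  by apply: KspanD; [rewrite w'E|apply: KspanZ].
have /a_uniq a_eq : w' = \sum_j mpolyC r ([ffun j => a2 (lift ord_max j)] j) *: b j.
  by move: eq_u; rewrite eq_max => /addrI.
apply/ffunP => i; rewrite ffunE; case: unliftP => [j ->|-> //].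
by rewrite a_eq ffunE.
Qed.

Lemma has_Kdim_ext A B d : A `<=>` B -> has_Kdim A d -> has_Kdim B d.
Proof. by move=> /seteqP ->. Qed.

End Span.

Lemma Kspan_map (K : fieldType) r r' (N : lmodType (mpoly r K))
    (N' : lmodType (mpoly r' K)) (f : N -> N') A B :
  (forall u v, f (u + v) = f u + f v) ->
  (forall a v, f (mpolyC r a *: v) = mpolyC r' a *: f v) ->
  (forall v, A v -> B (f v)) -> forall v, Kspan A v -> Kspan B (f v).
Proof.
move=> fD fZ AB v; elim=> [|a w u Aw _ IH].
  by rewrite -[0](scale0r 0) -(mpolyC0 r K) fZ mpolyC0 scale0r; constructor.
by rewrite fD fZ; constructor => //; apply: AB.
Qed.

Lemma max_element (X : eqType) (lt : X -> X -> Prop) (s : seq X) :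
  (forall x y z, lt x y -> lt y z -> lt x z) ->
  (forall x y, x != y -> lt x y \/ lt y x) -> s != [::] ->
  exists2 x, x \in s & forall y, y \in s -> y != x -> lt y x.
Proof.
move=> lt_trans lt_total; elim: s => // x [_ _|y s].
  by exists x; rewrite ?mem_head // => y; rewrite inE => /eqP ->; rewrite eqxx.
move=> /(_ isT)[z zs z_max] _.
have [->|ne] := eqVneq x z.
  by exists z; rewrite ?mem_head // => w; rewrite in_cons => /predU1P[->|/z_max//];
      rewrite eqxx.
have [xz|zx] := lt_total x z ne.
  exists z; first by rewrite in_cons zs orbT.
  by move=> w; rewrite in_cons => /predU1P[->|/z_max].
exists x; first exact: mem_head.
move=> w; rewrite in_cons => /predU1P[->|ws _]; first by rewrite eqxx.
by have [->//|nwz] := eqVneq w z; apply: lt_trans zx; apply: z_max.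
Qed.

(** Add the vectors in increasing order: each of them enlarges the span by one
    dimension or not at all. *)
Lemma has_Kdim_count (K : fieldType) r (N : lmodType (mpoly r K)) (X : eqType)
    (vec : X -> N) (lt : X -> X -> Prop) (s : seq X) :
  (forall x, ~ lt x x) -> (forall x y z, lt x y -> lt y z -> lt x z) ->
  (forall x y, x != y -> lt x y \/ lt y x) -> uniq s ->
  has_Kdim (Kspan [set vec x | x in [set` s]])
    (count (fun x => `[< ~ Kspan [set vec y | y in [set y | y \in s /\
        lt y x]] (vec x) >]) s).
Proof.
move=> lt_irr lt_trans lt_total.
have [n] := ubnP (size s); elim: n s => // n IH s lt_s us.
have [->|s_n0] := eqVneq s [::].
  by apply: has_Kdim0 => v [x].
have [x xs x_max] := max_element lt_trans lt_total s_n0.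
pose s' := rem x s; have perm_s := perm_to_rem xs.
have mem_s y : (y \in s) = (y == x) || (y \in s').
  by rewrite (perm_mem perm_s) in_cons.
have us' : uniq s' by apply: rem_uniq.
have x_s' : x \notin s' by rewrite mem_rem_uniqF.
have lt_max y : y \in s' -> lt y x.
  move=> ys'; apply: x_max; first by rewrite mem_s ys' orbT.
  by apply: contraNneq x_s' => <-.
have lt_s' : (size s' < n)%N by move: lt_s; rewrite (perm_size perm_s).
have dim_s' := IH _ lt_s' us'.
rewrite (seq.permP perm_s) /=.
have smaller : [set vec y | y in [set y | y \in s /\ lt y x]] =
    [set vec y | y in [set` s']].
  apply/seteqP; split=> _ [y /= yP <-]; exists y => //=.
    by case: yP; rewrite mem_s => /predU1P[-> /lt_irr|].
  by split; [rewrite mem_s yP orbT|apply: lt_max].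
have whole : [set vec y | y in [set` s]] = [set vec y | y in [set` s']] `|` [set vec x].
  apply/seteqP; split=> [_ [y /= + <-]|_ [[y /= ys' <-]|->]].
  - by rewrite mem_s => /predU1P[->|ys']; [right|left; exists y].
  - by exists y => //=; rewrite mem_s ys' orbT.
  - by exists x.
have countE : count (fun y => `[< ~ Kspan [set vec z | z in [set z | z \in s /\
    lt z y]] (vec y) >]) s'
    = count (fun y => `[< ~ Kspan [set vec z | z in [set z | z \in s' /\
        lt z y]] (vec y) >]) s'.
  apply: eq_in_count => y ys'; congr (`[< ~ Kspan _ _ >]).
  apply/seteqP; split=> _ [z /= [zs zy] <-]; exists z => //=; split=> //.
    move: zs; rewrite mem_s => /predU1P[eq_zx|//].
    by rewrite eq_zx in zy; case: (lt_irr x); apply: lt_trans zy _; apply: lt_max.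
  by rewrite mem_s zs orbT.
rewrite countE smaller whole;
    have [xin|xout] := pselect (Kspan [set vec y | y in [set` s']] (vec x)).
  rewrite asboolF ?add0n; last by move/(_ xin).
  apply: has_Kdim_ext dim_s'; split; first by apply: Kspan_mono => v; left.
  by apply: Kspan_sub => v [|->] //; apply: Kspan_in.
by rewrite asboolT //; apply: has_KdimS.
Qed.

(** * Standard monomials of a graded OI-module *)

Definition lexlt (u v : nat -> nat -> nat) := exists j i, (u j i < v j i)%N /\
  forall j' i', (j' < j)%N \/ j' = j /\ (i' < i)%N -> u j' i' = v j' i'.

Lemma lexlt_irr u : ~ lexlt u u.
Proof. by move=> [j [i []]]; rewrite ltnn. Qed.

Lemma lexlt_trans u v w : lexlt u v -> lexlt v w -> lexlt u w.
Proof.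
move=> [j [i [uv uvE]]] [j' [i' [vw vwE]]].
have [lt|[[eqj lt]|[[eqj eqi]|gt]]] : (j < j')%N \/ (j = j' /\ (i < i')%N) \/
    (j = j' /\ i = i') \/ ((j' < j)%N \/ j' = j /\ (i' < i)%N).
  case: (ltngtP j j') => [|lt|eqj]; [by left|by right; right; right; left|].
  case: (ltngtP i i') => [lt|gt|eqi]; right; first by left.
    by right; right; right.
  by right; left.
- exists j, i; split; first by rewrite -vwE //; left.
  move=> a b ab; rewrite uvE // vwE //; left.
  by case: ab => [/ltn_trans|[-> _]//]; apply.
- exists j, i; split; first by rewrite -vwE //; right.
  move=> a b ab; rewrite uvE // vwE //.
  by case: ab => [|[-> /ltn_trans]]; rewrite -eqj; [left|right; split=> //; auto].
- subst j' i'; exists j, i; split; first exact: ltn_trans uv vw.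
  by move=> a b ab; rewrite uvE ?vwE.
- exists j', i'; split; first by rewrite uvE.
  move=> a b ab; rewrite uvE ?vwE //.
  case: gt ab => [lt [/ltn_trans|[-> _]]|[-> lt] [|[-> /ltn_trans]]].
  + by left; auto.
  + by left.
  + by left.
  + by right; auto.
Qed.

Lemma lexlt_total u v : (exists j i, u j i <> v j i) -> lexlt u v \/ lexlt v u.
Proof.
move=> [j0 [i0 ne0]].
pose Q j := `[< exists i, u j i <> v j i >].
have exQ : exists j, Q j by exists j0; apply/asboolP; exists i0.
have [j /asboolP[i1 ne1] j_min] := ex_minnP exQ.
have exQ' : exists i, u j i != v j i by exists i1; apply/eqP.
have [i ne i_min] := ex_minnP exQ'.
have eq_lt j' i' : (j' < j)%N \/ j' = j /\ (i' < i)%N -> u j' i' = v j' i'.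
  case=> [lt|[-> lt]]; apply: contrapT => ne'.
    by move: lt; rewrite ltnNge j_min //; apply/asboolP; exists i'.
  by move: lt; rewrite ltnNge i_min //; apply/eqP.
case: (ltngtP (u j i) (v j i)) ne => // lt _; [left|right]; exists j, i; split=> //.
by move=> j' i' /eq_lt.
Qed.

Lemma map_preimage (X Y : eqType) (f : X -> Y) (s : seq Y) :
  (forall y, y \in s -> exists x, y = f x) -> exists t, map f t = s.
Proof.
elim: s => [|y s IH] f_onto; first by exists [::].
have [|t <-] := IH; first by move=> z zs; apply: f_onto; rewrite in_cons zs orbT.
by have [x ->] := f_onto y (mem_head _ _); exists (x :: t).
Qed.

Section Standard.
Variables (K : fieldType) (c : nat) (M : Cmodule K c OI) (G : Cgrading M).
Variables (I : finType) (dg : I -> nat) (gv : forall k, M (dg k)) (jg : I -> int).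
Hypothesis gv_homog : forall k, G (dg k) (jg k) (gv k).
Hypothesis gv_gen : forall S : (forall n, set (M n)), is_submodule S ->
  (forall k, S (dg k) (gv k)) -> forall n (v : M n), S n v.

(** The index of the element [x^a e_* g_k] of [M n]. *)
Definition elt n := {k : I & (mor OI (dg k) n * multinom (nvars c n))%type}.

Definition mkelt n k (e : mor OI (dg k) n) (a : multinom (nvars c n)) : elt n :=
  Tagged (fun k => (mor OI (dg k) n * multinom (nvars c n))%type) (e, a).

Definition vec n (x : elt n) : M n :=
  mpolyX K (tagged x).2 *: cmap (tagged x).1 (gv (tag x)).

Definition edeg n (x : elt n) : int := (mdeg (tagged x).2)%:Z + jg (tag x).

Definition ewd n (x : elt n) := enc (tagged x).1 (tagged x).2.

Definition act n n' (f : mor OI n n') (b : multinom (nvars c n')) (x : elt n) :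
    elt n' :=
  mkelt (mor_comp f (tagged x).1) (mnm_add b (pushm f (tagged x).2)).

Lemma vec_act n n' (f : mor OI n n') b (x : elt n) :
  vec (act f b x) = mpolyX K b *: cmap f (vec x).
Proof.
by rewrite /vec /act /= cmap_comp cmapZ push_mpolyX scalerA mpolyXD.
Qed.

Lemma edeg_act n n' (f : mor OI n n') b (x : elt n) :
  edeg (act f b x) = (mdeg b)%:Z + edeg x.
Proof. by rewrite /edeg /act /= mdegD mdeg_pushm PoszD addrA. Qed.

(** Position 0 holds the index of the generator; position [j.+1] holds the mark
    and the exponents at [j]. *)
Definition code n (x : elt n) (j i : nat) : nat :=
  if j is j'.+1 then
    if i is i'.+1 then nth 0%N (nth no_letter (ewd x) j').2 i'
    else (nth no_letter (ewd x) j').1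
  else if i is 0%N then enum_rank (tag x) else 0%N.

Lemma code_inj n (x y : elt n) : (forall j i, code x j i = code y j i) -> x = y.
Proof.
move=> xy; have eq_tag : tag x = tag y.
  by apply: enum_rank_inj; apply: val_inj; apply: (xy 0%N 0%N).
case: x y xy eq_tag => [k [e a]] [k' [e' a']] xy /= eq_tag.
subst k'; suff [-> ->] : e = e' /\ a = a' by [].
apply: enc_inj; apply: (@eq_from_nth _ no_letter); first by rewrite !size_enc.
rewrite size_enc => j jn; pose j' := Ordinal jn.
rewrite -[j]/(val j') !nth_enc; congr (_, _).
  have := xy j.+1 0%N; rewrite /code /ewd /= -[j]/(val j') !nth_enc /=.
  by case: (_ \in _); case: (_ \in _).
apply: (@eq_from_nth _ 0%N); first by rewrite !size_exps.
rewrite size_exps => i ic; have := xy j.+1 i.+1.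
by rewrite /code /ewd /= -[j]/(val j') !nth_enc.
Qed.

Definition shiftk n (b : multinom (nvars c n)) (j : 'I_n) (i : nat) : nat :=
  if i is i'.+1 then nth 0%N [seq mexp b i j | i <- enum 'I_c] i' else 0%N.

Lemma nth_exps_add n (b a : multinom (nvars c n)) (j : 'I_n) i (u : 'I_c -> nat) :
  (forall i, mexp a i j = u i) ->
  nth 0%N [seq mexp (mnm_add b a) i j | i <- enum 'I_c] i =
  (nth 0%N [seq mexp b i j | i <- enum 'I_c] i + nth 0%N [seq u i | i <- enum 'I_c] i)%N.
Proof.
move=> au; have [ic|ci] := ltnP i c;
    last by rewrite !nth_default // size_map size_enum_ord.
rewrite -[i]/(val (Ordinal ic)) !nth_exps (nth_map (Ordinal ic)) ?size_enum_ord //.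
by rewrite nth_ord_enum -au /mexp mnmDE.
Qed.

Lemma code_in n n' (f : mor OI n n') b (x : elt n) (j : 'I_n) i :
  code (act f b x) (f j).+1 i = (shiftk b (f j) i + code x j.+1 i)%N.
Proof.
rewrite /code /ewd /act /= !nth_enc; case: i => [|i] /=.
  rewrite add0n; congr (nat_of_bool _).
  apply/codomP/codomP => [[l]|[l ->]]; last by exists l; rewrite mor_compE.
  by rewrite mor_compE => /mor_inj ->; exists l.
by apply: nth_exps_add => i'; apply: pushm_in.
Qed.

Lemma code_out n n' (f : mor OI n n') b (x : elt n) (j : 'I_n') i :
  j \notin codom f -> code (act f b x) j.+1 i = shiftk b j i.
Proof.
move=> nj; rewrite /code /ewd /act /= !nth_enc; case: i => [|i] /=.
  case: codomP => // -[l jE]; case/negP: nj; rewrite jE mor_compE; exact: codom_f.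
rewrite (@nth_exps_add _ _ _ _ _ (fun=> 0%N)) => [|i']; last exact: pushm_out.
by rewrite -[RHS]addn0; congr (_ + _)%N; elim: (enum _) i => [|? s IH] [|i] /=.
Qed.

Lemma code_default n (x : elt n) j i : (n <= j)%N -> code x j.+1 i = 0%N.
Proof.
move=> nj; rewrite /code nth_default ?size_enc //; case: i => //= i.
exact: nth_nil.
Qed.

Definition elt_lt n (x y : elt n) := lexlt (code x) (code y).

Lemma elt_lt_total n (x y : elt n) : x != y -> elt_lt x y \/ elt_lt y x.
Proof.
move=> /eqP ne; apply: lexlt_total; apply: contrapT => eq_xy; apply: ne.
apply: code_inj => j i; apply: contrapT => ne; apply: eq_xy.
by exists j, i.
Qed.

(** At the positions in the image of [f], the codes of both elements grow by the
    same amount, and at the other positions they agree; so the first difference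
    moves along [f]. *)
Lemma elt_lt_act n n' (f : mor OI n n') b (x y : elt n) :
  elt_lt x y -> elt_lt (act f b x) (act f b y).
Proof.
move=> [[|j] [i [lt eq_lt]]].
  exists 0%N, i; split; first exact: lt.
  by case=> [|j'] i' [|[]] // _ ii'; apply: (eq_lt 0%N i'); right.
have jn : (j < n)%N.
  by rewrite ltnNge; apply/negP => nj; rewrite !code_default // in lt.
pose j' := Ordinal jn; exists (f j').+1, i; split.
  by rewrite !code_in ltn_add2l.
move=> [|j2] i2 jlt; first by apply: (eq_lt 0%N i2); left.
have [j2n|nj2] := ltnP j2 n'; last by rewrite !code_default.
rewrite -[j2]/(val (Ordinal j2n)).
have [/codomP[j3 E]|out] := boolP (Ordinal j2n \in codom f); last by rewrite !code_out.
rewrite E !code_in; congr (_ + _)%N; apply: eq_lt.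
have j2E : j2 = f j3 by rewrite -E.
case: (ltngtP j3 j') => [lt3|gt3|eq3]; first by left.
  have := mor_lt f gt3; rewrite -j2E => gt2.
  by case: jlt => [|[[eq2]]]; [rewrite ltnS ltnNge (ltnW gt2)|rewrite eq2 ltnn in gt2].
case: jlt => [|[_ lti]]; last by right; split=> //; rewrite eq3.
by rewrite j2E (_ : j3 = j') ?ltnn //; apply: val_inj.
Qed.

Definition nonstd n (x : elt n) :=
  Kspan [set vec y | y in [set y | elt_lt y x /\ edeg y = edeg x]] (vec x).

(** Structure maps and monomials preserve strict inequalities, hence
    multiples of nonstandard elements are nonstandard. *)
Lemma nonstd_act n n' (f : mor OI n n') b (x : elt n) :
  nonstd x -> nonstd (act f b x).
Proof.
rewrite /nonstd vec_act.
apply: (Kspan_map (f := fun u => mpolyX K b *: cmap f u)) => [u v|a v|v].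
- by rewrite cmapD scalerDr.
- rewrite cmapZ push_const !scalerA; congr (_ *: _); exact: mulrC.
- move=> [y /= [lt_yx deg_y] <-]; exists (act f b y); last exact: vec_act.
  by rewrite /= !edeg_act deg_y; split=> //; apply: elt_lt_act.
Qed.

(** The words that lie above no nonstandard one. Unlike the set of the words of
    standard elements, this is an order ideal of all words, including those that
    encode no element at all. *)
Definition stdset k : set (seq letter) := [set w | ~ exists n (e : mor OI (dg k) n) a,
  nonstd (mkelt e a) /\ word_le (enc e a) w].

Lemma stdset_down k : downset word_le (stdset k).
Proof.
move=> u v uv Sv [n [e [a [ns le_u]]]]; apply: Sv; exists n, e, a.
by split=> //; apply: word_le_trans uv.
Qed.

Lemma stdsetP n k (e : mor OI (dg k) n) a : stdset k (enc e a) <-> ~ nonstd (mkelt e a).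
Proof.
split=> [S ns|std [n0 [e0 [a0 [ns /word_le_enc[f [b [eE aE]]]]]]]].
  by apply: S; exists n, e, a; split=> //; apply: word_le_refl.
by apply: std; rewrite eE aE; apply: (nonstd_act f b ns).
Qed.

(** The spans of these vectors form a submodule that contains the generators. *)
Lemma Kspan_vec n (v : M n) : Kspan (range (@vec n)) v.
Proof.
apply: (gv_gen (S := fun n => Kspan (range (@vec n)))) => [|k].
  split.
  - by move=> m; constructor.
  - by move=> m u w; apply: KspanD.
  - move=> m a w; elim=> [|b u w' [x _ <-] _ IH]; first by rewrite scaler0; constructor.
    rewrite scalerDr; apply: KspanD IH; rewrite scalerA mulrC -scalerA.
    apply: KspanZ; rewrite [a]mpolyE scaler_suml; apply: Kspan_sum => d.
    rewrite -mul_mpolyC -scalerA; apply/KspanZ/Kspan_in.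
    exists (act (mor_id OI m) d x) => //.
    by rewrite vec_act cmap_id.
  - move=> m m' e u; apply: (Kspan_map (f := cmap e)) => [? ?|a w|_ [x _ <-]].
    + exact: cmapD.
    + by rewrite cmapZ push_const.
    + by exists (act e (@mnm0 _) x) => //; rewrite vec_act mpolyX0 scale1r.
apply: Kspan_in; exists (mkelt (mor_id OI _) (@mnm0 _)) => //.
by rewrite /vec /= mpolyX0 scale1r cmap_id.
Qed.

Lemma homog_mpolyX r (a : multinom r) : mpolyX K a \is ishomog1 (mdeg a) mdeg.
Proof. by rewrite dhomogX. Qed.

Lemma homog_mpolyC r (a : K) : mpolyC r a \is ishomog1 0%N mdeg.
Proof. by rewrite -[mpolyC r a]mulr1 mul_mpolyC dhomogZ // dhomog1. Qed.

Lemma hcompD r (N : lmodType (mpoly r K)) (H : grading N) j u v :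
  H j u -> H j v -> H j (u + v).
Proof.
move=> Hu Hv; rewrite -[v]opprK; apply: hcompB => //.
by rewrite -sub0r; apply: hcompB => //; apply: hcomp0.
Qed.

Lemma hcomp_vec n (x : elt n) : G n (edeg x) (vec x).
Proof.
by apply: hcompZ (homog_mpolyX _) _; apply: cmap_homog.
Qed.

(** Collect the terms of a linear combination by degree; since components are
    independent, only the part of degree [j] survives. *)
Lemma hcomp_Kspan n j : G n j = Kspan [set vec x | x in [set x | edeg x = j]].
Proof.
apply/seteqP; split=> v; last first.
  elim=> [|a _ u [x /= <- <-] _ IH]; first exact: hcomp0.
  apply: hcompD IH; rewrite -[edeg x]add0r.
  by apply: hcompZ (homog_mpolyC _ _) _; apply: hcomp_vec.
move=> Gv; pose A i := [set vec x | x in [set x : elt n | edeg x = i]].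
have [s [w [us wA vE]]] : exists (s : seq int) (w : int -> M n),
    [/\ uniq s, forall i, Kspan (A i) (w i) & v = \sum_(i <- s) w i].
  elim: (Kspan_vec v) => {v Gv} [|a _ u [x _ <-] _ [s [w [us wA ->]]]].
    by exists [::], (fun=> 0); split=> //; [constructor|rewrite big_nil].
  pose t := undup (edeg x :: s).
  pose w1 i := if i \in s then w i else 0.
  pose w2 i := if i == edeg x then mpolyC _ a *: vec x else 0.
  exists t, (fun i => w2 i + w1 i); split; first exact: undup_uniq.
    move=> i; apply: KspanD; rewrite /w1 /w2.
      case: eqP => [->|_]; last by constructor.
      by apply/KspanZ/Kspan_in; exists x.
    by case: ifP => // _; constructor.
  have xt : edeg x \in t by rewrite mem_undup mem_head.
  rewrite big_split /= (bigD1_seq _ xt) ?undup_uniq //= {1}/w2 eqxx.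
  rewrite [X in _ + X + _]big1 ?addr0 => [|i /negPf]; last by rewrite /w2 => ->.
  congr (_ + _); rewrite /w1 -big_mkcond -[RHS]big_filter; apply: perm_big.
  apply: uniq_perm => //; first by rewrite filter_uniq // undup_uniq.
  move=> i; rewrite mem_filter mem_undup in_cons andb_orr andbb.
  by case: (i \in s); rewrite ?orbT ?andbF.
have GA i u : Kspan (A i) u -> G n i u.
  elim=> [|a _ u' [x /= <- <-] _ IH]; first exact: hcomp0.
  apply: hcompD IH; rewrite -[edeg x]add0r.
  by apply: hcompZ (homog_mpolyC _ _) _; apply: hcomp_vec.
pose s' := undup (j :: s); pose w1 i := if i \in s then w i else 0.
have w1A i : Kspan (A i) (w1 i) by rewrite /w1; case: ifP => // _; constructor.
have vE' : v = \sum_(i <- s') w1 i.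
  rewrite vE /w1 -big_mkcond -[RHS]big_filter; apply: perm_big; apply: uniq_perm => //.
    by rewrite filter_uniq // undup_uniq.
  move=> i; rewrite mem_filter mem_undup in_cons andb_orr andbb.
  by case: (i \in s); rewrite ?orbT ?andbF.
have js' : j \in s' by rewrite mem_undup mem_head.
pose w2 i := w1 i - (if i == j then v else 0).
have : w2 j = 0.
  apply: (@hcomp_indep _ _ _ (G n) s' w2 (undup_uniq _) _ _ _ js') => [i|].
    by apply: hcompB; [apply: GA|case: eqP => [->|_] //; apply: hcomp0].
  rewrite sumrB -vE' (bigD1_seq _ js') ?undup_uniq //= eqxx big1 ?addr0 ?subrr //.
  by move=> i /negPf ->.
by rewrite /w2 eqxx => /eqP; rewrite subr_eq0 => /eqP <-; apply: w1A.
Qed.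

Definition std_count n (j : int) : nat :=
  (\sum_(k : I) if (jg k <= j)%R then count_words c (stdset k) n (dg k) `|j - jg k| else 0)%N.

Lemma has_Kdim_std_count n j : has_Kdim (G n j) (std_count n j).
Proof.
have el_ex (k : I) : exists el : seq (mor OI (dg k) n * multinom (nvars c n)),
    [seq enc p.1 p.2 | p <- el] = words c n (dg k) `|j - jg k|.
  by apply: map_preimage => w /words_enc[e [a [_ ->]]]; exists (e, a).
pose el k := projT1 (cid (el_ex k)).
have elP k : [seq enc p.1 p.2 | p <- el k] = words c n (dg k) `|j - jg k|.
  exact: projT2 (cid (el_ex k)).
have el_uniq k : uniq (el k) by apply: (@map_uniq _ _ (fun p => enc p.1 p.2));
    rewrite elP uniq_words.
have mem_el k e a : ((e, a) \in el k) = (mdeg a == `|j - jg k|%N).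
  apply/idP/eqP => [ea|deg_a].
    have : enc e a \in words c n (dg k) `|j - jg k|.
      by rewrite -elP; apply/mapP; exists (e, a).
    have := enc_words e a; rewrite !mem_words => /and4P[_ _ _ /eqP <-].
    by move=> /and4P[_ _ _ /eqP].
  have := enc_words e a; rewrite deg_a -elP => /mapP[[e' a'] ea' /= /enc_inj[-> ->]].
  exact: ea'.
pose blk k : seq (elt n) := if jg k <= j then [seq mkelt p.1 p.2 | p <- el k] else [::].
pose s : seq (elt n) := flatten [seq blk k | k <- enum I].
have s_uniq : uniq s.
  apply: (@uniq_flatten_map _ _ _ _ (fun x => tag x)); first exact: enum_uniq.
    move=> k; rewrite /blk; case: ifP => // _; rewrite map_inj_uniq //.
    by move=> [e a] [e' a'] /eqP; rewrite /mkelt /= eq_Tagged /= => /eqP.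
  by move=> k x; rewrite /blk; case: ifP => // _ /mapP[p _ ->].
have mem_s x : (x \in s) = (edeg x == j).
  case: x => k [e a]; rewrite /edeg /=; apply/flatten_mapP/eqP => [[k' _]|deg_x].
    rewrite /blk; case: ifP => // le_j /mapP[[e' a'] ea' E].
    have eq_k : k = k' := congr1 tag E; subst k'.
    move: E => /eqP; rewrite eq_Tagged /= => /eqP[_ ->].
    by move: ea'; rewrite mem_el => /eqP ->; lia.
  exists k; first by rewrite mem_enum.
  rewrite /blk ifT; last by rewrite -deg_x; lia.
  apply/mapP; exists (e, a) => //; rewrite mem_el; apply/eqP; lia.
have -> : G n j = Kspan [set vec x | x in [set` s]].
  rewrite hcomp_Kspan; congr (Kspan (image _ _)); apply/seteqP.
  by split=> x /=; rewrite mem_s => /eqP.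
have -> : std_count n j = count (fun x => `[< ~ Kspan [set vec y | y in
    [set y | y \in s /\ elt_lt y x]] (vec x) >]) s.
  rewrite count_flatten -map_comp sumnE big_map big_enum /std_count.
  apply: eq_bigr => k _ /=; rewrite /blk; case: ifP => // le_j.
  rewrite /count_words -elP !count_map; apply: eq_in_count => -[e a] /=.
  rewrite mem_el => /eqP deg_a; apply/asboolP/asboolP => [/stdsetP std ns|std].
    apply: std; apply: Kspan_mono ns => _ [y [ys lt_y] <-]; exists y => //; split=> //.
    by move: ys; rewrite mem_s /edeg /= deg_a => /eqP ->; lia.
  apply/stdsetP => ns; apply: std; apply: Kspan_mono ns => _ [y [lt_y deg_y] <-].
  exists y => //; split=> //; rewrite mem_s deg_y /edeg /= deg_a; apply/eqP; lia.
apply: has_Kdim_count => //.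
- by move=> x; apply: lexlt_irr.
- by move=> x y z; apply: lexlt_trans.
- exact: elt_lt_total.
Qed.

Lemma hilbert_funE n j : hilbert_fun (G n) j = std_count n j.
Proof.
have ex : [set d | has_Kdim (G n j) d] (std_count n j) by apply: has_Kdim_std_count.
apply: (has_Kdim_uniq (hcomp0 (G n) j)) (has_Kdim_std_count n j).
exact: (xgetI 0%N ex).
Qed.

Lemma cauchy_prod_monomial a f m :
  cauchy_prod (fun i => i == a) f m = if (a <= m)%N then f (m - a)%N else 0%N.
Proof.
rewrite /cauchy_prod; case: leqP => [am|ma].
  rewrite (bigD1 (inord a)) //= inordK ?ltnS // eqxx mul1n big1 ?addn0 // => i ne.
  by case: eqP => // ia; rewrite -ia inord_val eqxx in ne.
by apply: big1 => i _; case: eqP => // ia; move: (ltn_ord i); rewrite ia ltnS leqNgt ma.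
Qed.

Lemma hilbert_linear_growth : exists s : nat,
  [/\ forall n j, has_Kdim (G n j) (hilbert_fun (G n) j),
      forall n (j : int), j < - s%:Z -> hilbert_fun (G n) j = 0%N
    & linear_growth c (fun n m => hilbert_fun (G n) (m%:Z - s%:Z))].
Proof.
pose s := (\sum_k `|jg k|)%N; exists s.
have jg_s k : (`|jg k| <= s)%N by rewrite /s (bigD1 k) //= leq_addr.
split=> [n j|n j lt|]; first by rewrite hilbert_funE; apply: has_Kdim_std_count.
  rewrite hilbert_funE; apply: big1 => k _; case: ifP => // le.
  by have := jg_s k; lia.
pose a k := absz (s%:Z + jg k).
have : linear_growth c (fun n m => \sum_(k <- enum I)
    cauchy_prod (fun i => i == a k) (count_words c (stdset k) n (dg k)) m)%N.
  apply: (linear_growth_sum (P := predT)) => k _ _.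
  apply: (linear_growth_cauchy_prod (X := fun n =>
      count_words c (stdset k) n (dg k)) (has_pole_monomial _)).
  by apply: linear_growth_words; apply: stdset_down.
apply: linear_growth_ext => n m; rewrite hilbert_funE /std_count big_enum;
    apply: eq_bigr => k _.
rewrite cauchy_prod_monomial; have := jg_s k; rewrite /a => le_s.
case: leqP => le; case: ifP => le' //; try by lia.
by congr (count_words _ _ _ _ _); lia.
Qed.

End Standard.

(** * Restriction to OI and homogeneous generators *)

Definition generates (K : fieldType) c C (M : Cmodule K c C) (I : Type)
    (g : I -> {n : nat & M n}) :=
  forall S : (forall n, set (M n)), is_submodule S ->
    (forall i, S (projT1 (g i)) (projT2 (g i))) -> forall n (v : M n), S n v.

Section Restriction.
Variables (K : fieldType) (c : nat) (C : indexcat) (M : Cmodule K c C).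

Lemma is_mor_incr m n (e : mor OI m n) : is_mor C (val e).
Proof.
case: C; first exact: (valP e).
by apply/injectiveP => i j /(@mor_inj _ _ e).
Qed.

Definition of_incr m n (e : mor OI m n) : mor C m n := Sub (val e) (is_mor_incr e).

Lemma of_incrE m n (e : mor OI m n) i : of_incr e i = e i.
Proof. by []. Qed.

Lemma of_incr_id n : of_incr (mor_id OI n) = mor_id C n.
Proof. exact: val_inj. Qed.

Lemma of_incr_comp m n p (f : mor OI n p) (e : mor OI m n) :
  of_incr (mor_comp f e) = mor_comp (of_incr f) (of_incr e).
Proof. exact: val_inj. Qed.

Lemma restrict_mapZ m n (e : mor OI m n) (a : P K c m) (v : M m) :
  cmap (of_incr e) (a *: v) = push e a *: cmap (of_incr e) v.
Proof. exact: cmapZ. Qed.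

Lemma restrict_id n (v : M n) : cmap (of_incr (mor_id OI n)) v = v.
Proof. by rewrite of_incr_id cmap_id. Qed.

Lemma restrict_comp m n p (f : mor OI n p) (e : mor OI m n) (v : M m) :
  cmap (of_incr (mor_comp f e)) v = cmap (of_incr f) (cmap (of_incr e) v).
Proof. by rewrite of_incr_comp cmap_comp. Qed.

Definition restrict : Cmodule K c OI := @CModule K c OI M
  (fun m n e => cmap (of_incr e)) (fun m n e => cmapD (of_incr e))
  restrict_mapZ restrict_id restrict_comp.

Definition restrict_grading (G : Cgrading M) : Cgrading restrict :=
  @CGrading K c OI restrict G (fun m n e => @cmap_homog _ _ _ _ G m n (of_incr e)).

(** List the image of the morphism in increasing order. *)
Lemma mor_factor m n (e : mor C m n) : exists (f : mor OI m n) (p : mor C m m),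
  e = mor_comp (of_incr f) p.
Proof.
have [f fE] : exists f : mor OI m n, codom e =i codom f.
  have e_inj : injective e.
    by case: C e => e; [exact: mor_inj|exact: (injectiveP _ (valP e))].
  pose A : {set 'I_n} := finset (mem (codom e)).
  have cardA : #|A| = m by rewrite cardsE card_codom // card_ord.
  by have [f fA] := mor_of_set cardA; exists f => j; rewrite fA finset.in_set.
have /choice[p pE] i : exists j, e i = f j.
  by apply/codomP; rewrite -fE codom_f.
have pP : is_mor C [ffun i => p i].
  case: C e fE pE => e fE pE.
    apply/forallP => i; apply/forallP => j; apply/implyP => /(mor_lt e).
    rewrite !pE !ffunE; case: (ltngtP (p i) (p j)) => // [/(mor_lt f)|eq_p].
      by rewrite ltnNge => /negP nlt /ltnW /nlt.
    by rewrite (val_inj eq_p : p i = p j) ltnn.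
  apply/injectiveP => i j; rewrite !ffunE => pij.
  by apply: (injectiveP _ (valP e)); rewrite -/(e i) -/(e j) !pE pij.
exists f, (Sub [ffun i => p i] pP); apply: mor_ext => i.
by rewrite mor_compE of_incrE pE /mor_fun SubK ffunE.
Qed.

Definition restrict_gen (I : Type) (g : I -> {n : nat & M n})
    (x : {i : I & mor C (projT1 (g i)) (projT1 (g i))}) : {n : nat & restrict n} :=
  existT (fun n => restrict n) (projT1 (g (tag x))) (cmap (tagged x) (projT2 (g (tag x)))).

(** The vectors whose images under all morphisms of [C] lie in an OI-submodule [S]
    form a submodule for [C]. *)
Lemma restrict_generates (I : Type) (g : I -> {n : nat & M n}) :
  generates g -> generates (restrict_gen (g := g)).
Proof.
move=> gen_g S S_sub gS n v.
pose S' n : set (M n) := [set u | forall p (e : mor C n p), S p (cmap e u)].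
have : S' n v.
  apply: gen_g => [|i]; first split.
  - move=> m p e; have -> : cmap e (0 : M m) = 0.
      by rewrite -[0 in LHS](scale0r 0) cmapZ push_const scale0r.
    exact: (submod0 S_sub).
  - by move=> m u w Su Sw p e; rewrite cmapD; apply: (submodD S_sub);
      [apply: Su|apply: Sw].
  - by move=> m a u Su p e; rewrite cmapZ; apply: (submodZ S_sub); apply: Su.
  - by move=> m p e u Su q f; rewrite -cmap_comp; apply: Su.
  move=> p e; have [f [s ->]] := mor_factor e; rewrite cmap_comp.
  exact: (submod_map S_sub f (gS (existT _ i s))).
by move=> /(_ n (mor_id C n)); rewrite cmap_id.
Qed.

End Restriction.

Lemma homogeneous_generators (K : fieldType) c C (M : Cmodule K c C) (G : Cgrading M)
    (I : finType) (g : I -> {n : nat & M n}) : generates g ->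
  exists (J : finType) (dg : J -> nat) (gv : forall k, M (dg k)) (jg : J -> int),
    (forall k, G (dg k) (jg k) (gv k)) /\
    forall S : (forall n, set (M n)), is_submodule S ->
      (forall k, S (dg k) (gv k)) -> forall n (v : M n), S n v.
Proof.
move=> gen_g; pose d i := projT1 (g i).
have span i := cid (hcomp_span (G (d i)) (projT2 (g i))).
pose s i := projT1 (span i); pose wP i := cid (projT2 (span i)).
pose w i := projT1 (wP i).
have wG i j : G (d i) j (w i j) by case: (projT2 (wP i)).
have gE i : projT2 (g i) = \sum_(j <- s i) w i j by case: (projT2 (wP i)).
exists {i : I & 'I_(size (s i))}, (fun x => d (tag x)).
pose jg (x : {i : I & 'I_(size (s i))}) : int :=
  nth 0 (s (tag x)) (tagged x : 'I_(size (s (tag x)))).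
exists (fun x => w (tag x) (jg x)), jg; split=> [k|S S_sub gS n v].
  exact: wG.
apply: gen_g => // i; rewrite gE (big_nth 0) big_mkord.
apply: (big_ind (S (d i))); first exact: (submod0 S_sub).
  by move=> u u'; apply: (submodD S_sub).
by move=> j _; apply: (gS (Tagged (fun i => 'I_(size (s i))) j)).
Qed.

Lemma hilbert_linear_growth_gen (K : fieldType) c C (M : Cmodule K c C) (G :
    Cgrading M) :
  finitely_generated M -> exists s : nat,
  [/\ forall n j, has_Kdim (G n j) (hilbert_fun (G n) j),
      forall n (j : int), j < - s%:Z -> hilbert_fun (G n) j = 0%N
    & linear_growth c (fun n m => hilbert_fun (G n) (m%:Z - s%:Z))].
Proof.
move=> [k [gen genP]].
have gen_r := @restrict_generates K c C M _ gen genP.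
have [J [dg [gv [jg [gvG gvP]]]]] :=
  @homogeneous_generators K c OI (restrict M) (restrict_grading G) _ _ gen_r.
exact: (hilbert_linear_growth gvG gvP).
Qed.

(** * Dimension and degree *)

(** Forms with different shifts [s] become comparable after a further shift. *)
Lemma hilbert_form_has_pole h D s p t : hilbert_form h D s p ->
  has_pole (fun m => h (m%:Z - (s + t)%N%:Z)) D p.[1].
Proof.
move=> [h0 hp _].
have form_s : has_pole (fun m => h (m%:Z - s%:Z)) D p.[1] by exists p => //;
    apply/has_poleE.
have := has_pole_cauchy_prod (has_pole_monomial t) form_s; rewrite mul1r;
    apply: has_pole_ext => m.
rewrite cauchy_prod_monomial; case: leqP => le; first by congr (h _); lia.
by rewrite h0 //; lia.
Qed.

Section Invariants.
Variables (K : fieldType) (r : nat) (N : lmodType (mpoly r K)) (H : grading N).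
Variables (s D : nat) (e : int).
Hypothesis low : forall j, j < - s%:Z -> hilbert_fun H j = 0%N.
Hypothesis e_n0 : e != 0.
Hypothesis form : has_pole (fun m => hilbert_fun H (m%:Z - s%:Z)) D e.

Lemma hilbert_form_ex : exists2 p, hilbert_form (hilbert_fun H) D s p & p.[1] = e.
Proof.
case: form => p p1 /has_poleE fp; exists p => //; split=> //; last by rewrite p1.
Qed.

Lemma hilbert_form_uniq D' s' p' : hilbert_form (hilbert_fun H) D' s' p' ->
  D' = D /\ p'.[1] = e.
Proof.
move=> form'; have [p form0 p1] := hilbert_form_ex.
have h' := hilbert_form_has_pole s form'; have h := hilbert_form_has_pole s' form0.
rewrite addnC p1 in h; apply: has_pole_uniq h' h => //.
by case: form'.
Qed.

Lemma mdimE : mdim H = D.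
Proof.
have [p form0 p1] := hilbert_form_ex.
have ex : [set D' | exists s p, hilbert_form (hilbert_fun H) D' s p] D by exists s, p.
by have [s' [p' /hilbert_form_uniq[]]] := xgetI 0%N ex.
Qed.

Lemma mdegreeE : mdegree H = e.
Proof.
have [p form0 p1] := hilbert_form_ex.
have ex : [set g1 | exists D s p, hilbert_form (hilbert_fun H) D s p /\ g1 = p.[1]] e.
  by exists D, s, p.
have [D' [s' [p' [form' E]]]] := xgetI 0 ex.
by have [_ <-] := hilbert_form_uniq form'.
Qed.

End Invariants.

(** * Limits *)

Section Limits.
Variable R : realType.
Implicit Types (u v : nat -> R).

Lemma cvg_eventually u v (l : R) n0 : (forall n, (n0 <= n)%N -> u n = v n) ->
  u @ \oo --> l -> v @ \oo --> l.
Proof.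
move=> uv; apply: cvg_trans; apply: near_eq_cvg.
by exists n0 => // n /= le; rewrite uv.
Qed.

Lemma cvg_natV : (fun n : nat => (n%:R : R)^-1) @ \oo --> (0 : R).
Proof. by rewrite -(cvg_shiftS _); exact: cvg_harmonic. Qed.

Lemma cvg_mul u v (a b : R) : u @ \oo --> a -> v @ \oo --> b ->
  (fun n => u n * v n) @ \oo --> a * b.
Proof. by move=> ua vb; apply: cvgM. Qed.

Lemma cvg_add u v (a b : R) : u @ \oo --> a -> v @ \oo --> b ->
  (fun n => u n + v n) @ \oo --> a + b.
Proof. by move=> ua vb; apply: cvgD. Qed.

Lemma cvg_pow u (a : R) k : u @ \oo --> a -> (fun n => u n ^+ k) @ \oo --> a ^+ k.
Proof.
move=> ua; elim: k => [|k IH].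
  by rewrite expr0; under eq_fun do rewrite expr0; apply: cvg_cst.
by rewrite exprS; under eq_fun do rewrite exprS; apply: cvg_mul.
Qed.

Lemma cvg_sum_ord N (F : nat -> nat -> R) (l : nat -> R) :
  (forall i, (i < N)%N -> F i @ \oo --> l i) ->
  (fun n => \sum_(i < N) F i n) @ \oo --> \sum_(i < N) l i.
Proof.
elim: N => [_|N IH FN].
  by rewrite big_ord0; under eq_fun do rewrite big_ord0; apply: cvg_cst.
rewrite big_ord_recr; under eq_fun do rewrite big_ord_recr.
by apply: cvg_add; [apply: IH => i /ltnW/FN|apply: FN].
Qed.

Lemma cvg_ffact k :
  (fun n : nat => (n ^_ k)%:R / n%:R ^+ k : R) @ \oo --> (1 : R).
Proof.
elim: k => [|k IH].
  by under eq_fun do rewrite ffactn0 expr0 divr1; apply: cvg_cst.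
have lim1 : (fun n : nat => 1 - k%:R / n%:R : R) @ \oo --> (1 : R).
  have : (fun n : nat => 1 - k%:R / n%:R : R) @ \oo --> (1 - k%:R * 0 : R).
    apply: cvg_add; first exact: cvg_cst.
    by apply: cvgN; apply: cvg_mul cvg_natV; apply: cvg_cst.
  by rewrite mulr0 subr0.
have := cvg_mul IH lim1; rewrite mulr1; apply: (@cvg_eventually _ _ _ k.+1) => n lt_kn.
have n0 : (n%:R : R) != 0 by rewrite pnatr_eq0; case: n lt_kn.
rewrite ffactnSr natrM natrB ?(ltnW lt_kn) // exprS.
have nk0 : (n%:R : R) ^+ k != 0 by rewrite expf_neq0.
by move: (_ ^+ k) (_ ^_ k)%:R nk0 => x y x0; field; rewrite x0 n0.
Qed.

Lemma cvg_bin k L : (k <= L)%N -> (fun n : nat => 'C(n, k)%:R / n%:R ^+ L : R) @ \oo -->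
  (if k == L then (L`!%:R)^-1 : R else 0).
Proof.
move=> le; have lim : (fun n : nat => (n ^_ k)%:R / n%:R ^+ k / k`!%:R *
     (n%:R)^-1 ^+ (L - k) : R) @ \oo --> (1 / k`!%:R * 0 ^+ (L - k) : R).
  apply: cvg_mul; last by apply: cvg_pow cvg_natV.
  by apply: cvg_mul; [exact: cvg_ffact|apply: cvg_cst].
have -> : (if k == L then (L`!%:R)^-1 else 0 : R) = 1 / k`!%:R * 0 ^+ (L - k).
  case: eqP le => [->|/eqP ne] le; first by rewrite subnn expr0 mulr1 div1r.
  by rewrite expr0n subn_eq0 leqNgt ltn_neqAle ne le mulr0.
move: lim; apply: (@cvg_eventually _ _ _ 1%N) => n n_gt0.
have n0 : (n%:R : R) != 0 by rewrite pnatr_eq0 -lt0n.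
have k0 : (k`!%:R : R) != 0 by rewrite pnatr_eq0 -lt0n fact_gt0.
rewrite -[in RHS](subnKC le) exprD -bin_ffact natrM exprVn.
have nk0 : (n%:R : R) ^+ k != 0 by rewrite expf_neq0.
have nLk0 : (n%:R : R) ^+ (L - k) != 0 by rewrite expf_neq0.
move: (_ ^+ k) (_ ^+ (L - k)) 'C(n, k)%:R k`!%:R k0 nk0 nLk0 => x y b f f0 x0 y0.
by field; rewrite f0 x0 y0.
Qed.

(** The binomial expansion of [(1 + h)^n], where [1 + h] is the quotient of the
    bases, contains a term of higher degree in [n]. *)
Lemma cvg_geom_bin (a b k L : nat) : (a < b)%N ->
  (fun n : nat => (a.+1%:R ^+ n * 'C(n, k)%:R) / (b.+1%:R ^+ n * n%:R ^+ L) : R)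
    @ \oo --> (0 : R).
Proof.
move=> ab; pose h : R := b.+1%:R / a.+1%:R - 1.
have a0 : 0 < (a.+1%:R : R) by rewrite ltr0n.
have b0 : 0 < (b.+1%:R : R) by rewrite ltr0n.
have h0 : 0 < h by rewrite subr_gt0 ltr_pdivlMr // mul1r ltr_nat ltnS.
have hE : b.+1%:R = (1 + h) * a.+1%:R by rewrite addrC subrK mulfVK // gt_eqF.
clearbody h; pose C := (k.+1%:R : R) / h ^+ k.+1.
have C0 : 0 <= C by rewrite divr_ge0 ?ler0n // exprn_ge0 // ltW.
have key n : (k < n)%N ->
    (a.+1%:R ^+ n * 'C(n, k)%:R) / (b.+1%:R ^+ n * n%:R ^+ L) <= C / (n - k)%N%:R.
  move=> kn; have nk0 : 0 < ((n - k)%N%:R : R) by rewrite ltr0n subn_gt0.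
  have an0 : 0 < (a.+1%:R : R) ^+ n by rewrite exprn_gt0.
  have n1 : 1 <= (n%:R : R) ^+ L by rewrite exprn_ege1 // ler1n (leq_trans _ kn).
  have hk0 : 0 < h ^+ k.+1 by rewrite exprn_gt0.
  have big : 'C(n, k.+1)%:R * h ^+ k.+1 <= (1 + h) ^+ n.
    rewrite exprDn; under eq_bigr do rewrite expr1n mul1r.
    rewrite (bigD1 (Ordinal (kn : (k.+1 < n.+1)%N))) //= mulr_natl lerDl.
    by apply: sumr_ge0 => i _; rewrite mulrn_wge0 // exprn_ge0 // ltW.
  have h1 : 0 < (1 + h) ^+ n by rewrite exprn_gt0 // addr_gt0.
  rewrite hE exprMn ler_pdivrMr; last by rewrite !mulr_gt0 // (lt_le_trans ltr01).
  have binE : ('C(n, k)%:R : R) * (n - k)%N%:R = k.+1%:R * 'C(n, k.+1)%:R.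
    by rewrite -!natrM mulnC -mul_bin_left.
  have -> : ('C(n, k)%:R : R) = k.+1%:R * 'C(n, k.+1)%:R / (n - k)%N%:R.
    by rewrite -binE mulfK // gt_eqF.
  have -> : a.+1%:R ^+ n * (k.+1%:R * 'C(n, k.+1)%:R / (n - k)%N%:R) =
      C / (n - k)%N%:R * ('C(n, k.+1)%:R * h ^+ k.+1 * a.+1%:R ^+ n).
    by rewrite /C; field; rewrite !gt_eqF.
  apply: ler_wpM2l; first by rewrite divr_ge0 // ltW.
  rewrite -[leLHS]mulr1; apply: ler_pM => //.
    by rewrite !mulr_ge0 ?ler0n // ltW.
  by rewrite ler_wpM2r // ltW.
have up : (fun n : nat => C / (n - k)%N%:R : R) @ \oo --> (0 : R).
  rewrite -(cvg_shiftn k) /=; under eq_fun do rewrite addnK.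
  have := cvg_mul (cvg_cst C) cvg_natV; rewrite mulr0; exact.
apply: squeeze_cvgr (cvg_cst 0) up; exists k.+1 => // n /= kn.
by rewrite key // andbT divr_ge0 // mulr_ge0 // ?exprn_ge0 ?ler0n.
Qed.

Lemma ratr_exp_eval P n : ratr (exp_eval P n) = \sum_(m < size P) \sum_(k < size P`_m)
  (ratr P`_m`_k : R) * (m.+1%:R ^+ n * 'C(n, k)%:R).
Proof.
rewrite /exp_eval rmorph_sum; apply: eq_bigr => m _.
rewrite rmorphM rmorphXn /= ratr_nat /bin_eval rmorph_sum mulr_sumr.
by apply: eq_bigr => k _; rewrite rmorphM /= ratr_nat mulrCA.
Qed.

(** The largest base and the degree of its coefficient determine the growth. *)
Lemma ev_expoly_limit (e : nat -> int) n0 : ev_expoly e ->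
  (forall n, (n0 <= n)%N -> 0 < e n) ->
  exists (Mu L : nat) (q : rat), [/\ (0 < Mu)%N, 0 < q &
    (fun n : nat => (e n)%:~R / (Mu%:R ^+ n * n%:R ^+ L) : R) @ \oo --> (ratr q : R)].
Proof.
move=> [y [P yP] [n1 eE]] e_gt0.
have P0 : P != 0.
  apply/eqP => P0; pose n := maxn n0 n1.
  have := e_gt0 n (leq_maxl _ _); rewrite -(ltr0z rat) eE ?leq_maxr //.
  by rewrite yP P0 /exp_eval size_poly0 big_ord0 ltxx.
pose b := (size P).-1; have sP : size P = b.+1 by rewrite prednK // lt0n size_poly_eq0.
pose p := P`_b; have p0 : p != 0 by rewrite -[p]/(lead_coef P) lead_coef_eq0.
pose L := (size p).-1; have sp : size p = L.+1 by rewrite prednK // lt0n size_poly_eq0.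
pose q := p`_L / L`!%:R.
have lim : (fun n : nat => (e n)%:~R / (b.+1%:R ^+ n * n%:R ^+ L) : R) @ \oo
    --> (ratr q : R).
  pose tau m k : R := ratr P`_m`_k * if (m == b) && (k == L) then (L`!%:R)^-1 else 0.
  have -> : ratr q = \sum_(m < size P) \sum_(k < size P`_m) tau m k.
    rewrite sP (bigD1 ord_max) //= [X in _ + X]big1 ?addr0 => [|i /negPf ne].
      rewrite -/p sp (bigD1 ord_max) //= big1 ?addr0 => [|i /negPf ne].
        by rewrite /tau !eqxx /q fmorph_div /= ratr_nat.
      by rewrite /tau -val_eqE /= in ne *; rewrite ne andbF mulr0.
    by apply: big1 => k _; rewrite /tau -val_eqE /= in ne *; rewrite ne mulr0.
  suff : (fun n => \sum_(m < size P) \sum_(k < size P`_m) (ratr P`_m`_k : R) *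
      ((m.+1%:R ^+ n * 'C(n, k)%:R) / (b.+1%:R ^+ n * n%:R ^+ L))) @ \oo -->
      \sum_(m < size P) \sum_(k < size P`_m) tau m k.
    apply: (@cvg_eventually _ _ _ n1) => n le; have -> : ((e n)%:~R : R) =
        ratr (exp_eval P n).
      rewrite -yP -eE // ratr_int; exact: erefl.
    rewrite ratr_exp_eval mulr_suml; apply: eq_bigr => m _.
    by rewrite mulr_suml; apply: eq_bigr => k _; apply: mulrA.
  pose F m k n : R := ratr P`_m`_k *
    ((m.+1%:R ^+ n * 'C(n, k)%:R) / (b.+1%:R ^+ n * n%:R ^+ L)).
  apply: (@cvg_sum_ord _ (fun m n => \sum_(k < size P`_m) F m k n)
    (fun m => \sum_(k < size P`_m) tau m k)) => m m_lt.
  apply: (@cvg_sum_ord _ (fun k n => F m k n) (tau m)) => k k_lt.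
  apply: cvg_mul; first exact: cvg_cst.
  move: m_lt k_lt; rewrite sP ltnS leq_eqVlt => /predU1P[->|lt_mb _].
    rewrite -/p sp ltnS eqxx => /cvg_bin; apply: (@cvg_eventually _ _ _ 0%N) => n _.
    have bn0 : (b.+1%:R : R) ^+ n != 0 by rewrite expf_neq0 // pnatr_eq0.
    by rewrite -mulf_div divff // mul1r.
  by rewrite ltn_eqF //=; apply: cvg_geom_bin.
exists b.+1, L, q; split=> //.
have q0 : q != 0.
  rewrite mulf_neq0 // ?invr_eq0 ?pnatr_eq0 -?lt0n ?fact_gt0 //.
  by rewrite -[p`_L]/(lead_coef p) lead_coef_eq0.
rewrite lt_neqAle eq_sym q0 -(ler0q R) /=.
apply: (ler_cvg_to (cvg_cst 0) lim); exists n0 => // n /= le.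
apply: divr_ge0; first by rewrite ler0z ltW // e_gt0.
by rewrite mulr_ge0 // exprn_ge0 // ler0n.
Qed.

Lemma cvg_ln_div : (fun n : nat => ln (n%:R : R) / n%:R) @ \oo --> (0 : R).
Proof.
(* ln n = 2 ln (sqrt n) <= 2 sqrt n *)
pose S n : R := Num.sqrt n%:R^-1.
have S0 : (fun n => 2 * S n) @ \oo --> (0 : R).
  have S_lim : S @ \oo --> Num.sqrt (0 : R).
    by apply: continuous_cvg cvg_natV; apply: sqrt_continuous.
  have := cvg_mul (cvg_cst (2 : R)) S_lim; rewrite sqrtr0 mulr0; exact.
apply: squeeze_cvgr (cvg_cst 0) S0; exists 1%N => // n /= n1.
have n0 : 0 < (n%:R : R) by rewrite ltr0n.
rewrite divr_ge0 ?ln_ge0 ?ler1n ?ler0n //= ler_pdivrMr //.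
have s0 : 0 < Num.sqrt (n%:R : R) by rewrite sqrtr_gt0.
have sE : Num.sqrt (n%:R : R) ^+ 2 = n%:R by rewrite sqr_sqrtr // ltW.
have SE : S n * n%:R = Num.sqrt (n%:R : R).
  by rewrite /S sqrtrV ?ltW // -[X in _ * X]sE expr2 mulrA mulVf ?mul1r // gt_eqF.
rewrite -mulrA SE -[in leLHS]sE lnXn // mulr_natl lerMn2r /=.
exact/ltW/ln_sublinear.
Qed.

(** The logarithm of the root is [ln Mu] up to terms that tend to 0. *)
Lemma root_limit u (Mu L : nat) (l : R) n0 : (0 < Mu)%N -> 0 < l ->
  (forall n, (n0 <= n)%N -> 0 < u n) ->
  (fun n : nat => u n / (Mu%:R ^+ n * n%:R ^+ L)) @ \oo --> l ->
  (fun n : nat => u n `^ (n%:R^-1)) @ \oo --> (Mu%:R : R).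
Proof.
move=> Mu0 l0 u0 u_l; pose v n : R := u n / (Mu%:R ^+ n * n%:R ^+ L).
have MuR : 0 < (Mu%:R : R) by rewrite ltr0n.
have ln_v : (fun n => ln (v n)) @ \oo --> ln l.
  by apply: continuous_cvg u_l; apply: continuous_ln.
have lim : (fun n : nat => ln (v n) * n%:R^-1 + ln Mu%:R + L%:R * (ln n%:R / n%:R) : R)
    @ \oo --> (ln l * 0 + ln Mu%:R + L%:R * 0 : R).
  apply: cvg_add; last by apply: cvg_mul cvg_ln_div; apply: cvg_cst.
  by apply: cvg_add; [apply: cvg_mul ln_v cvg_natV|apply: cvg_cst].
have : (fun n : nat => expR (ln (v n) * n%:R^-1 + ln Mu%:R + L%:R * (ln n%:R / n%:R)) : R)
    @ \oo --> expR (ln l * 0 + ln Mu%:R + L%:R * 0 : R).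
  by apply: continuous_cvg lim; apply: continuous_expR.
rewrite !mulr0 add0r addr0 lnK ?posrE //.
apply: (@cvg_eventually _ _ _ (maxn n0 1)) => n; rewrite geq_max => /andP[le n1] /=.
have n_gt0 : 0 < (n%:R : R) by rewrite ltr0n.
have Mn : 0 < (Mu%:R : R) ^+ n by rewrite exprn_gt0.
have nL : 0 < (n%:R : R) ^+ L by rewrite exprn_gt0.
rewrite /powR gt_eqF ?u0 //; congr expR.
have v0 : 0 < v n by rewrite divr_gt0 ?u0 // mulr_gt0.
have -> : u n = v n * (Mu%:R ^+ n * n%:R ^+ L) by rewrite /v mulfVK // gt_eqF // mulr_gt0.
move: (v n) v0 => x x0;
    rewrite !lnM ?posrE ?mulr_gt0 // !lnXn // -[_ *+ n]mulr_natl -[_ *+ L]mulr_natl.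
by field; rewrite gt_eqF.
Qed.

Lemma cvg_lin (d : nat -> nat) (A : nat) (B : int) n0 :
  (forall n, (n0 <= n)%N -> (d n)%:Z = A%:Z * n%:Z + B) ->
  (fun n : nat => (d n)%:R / n%:R : R) @ \oo --> (A%:R : R).
Proof.
move=> dE; have lim : (fun n : nat => A%:R + B%:~R * n%:R^-1 :
    R) @ \oo --> (A%:R + B%:~R * 0 : R).
  by apply: cvg_add; [apply: cvg_cst|apply: cvg_mul cvg_natV; apply: cvg_cst].
rewrite mulr0 addr0 in lim.
move: lim; apply: (@cvg_eventually _ _ _ (maxn n0 1)) => n; rewrite geq_max =>
    /andP[le n1].
have n_gt0 : 0 < (n%:R : R) by rewrite ltr0n.
have -> : ((d n)%:R : R) = A%:R * n%:R + B%:~R.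
  by rewrite -[LHS]/((d n)%:~R) pmulrn dE // rmorphD rmorphM.
by field; rewrite gt_eqF.
Qed.

End Limits.

Lemma has_Kdim0_eq0 (K : fieldType) r (N : lmodType (mpoly r K)) (H : grading N) :
  (forall j, has_Kdim (H j) 0) -> forall v : N, v = 0.
Proof.
move=> dim0 v; have [s [w [Hw ->]]] := hcomp_span H v; apply: big1 => j _.
have [b [_ bP]] := dim0 j; have [a [-> _]] := bP _ (Hw j).
by rewrite big_ord0.
Qed.

Theorem theorem5p14 (R : realType) (K : fieldType) (c : nat) (hc : (1 <= c)%N)
    (C : indexcat) (M : Cmodule K c C) (G : Cgrading M)
    (hfg : finitely_generated M)
    (hM : exists n0 : nat, forall n, (n0 <= n)%N -> exists v : M n, v != 0) :
  exists (A : nat) (B : int) (Mu L : nat),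
    [/\ (A <= c)%N /\ (0 < Mu)%N,
        exists n0 : nat, forall n, (n0 <= n)%N ->
          (mdim (G n))%:Z = A%:Z * n%:Z + B,
        exists2 q : rat, 0 < q &
          (fun n : nat => (mdegree (G n))%:~R / (Mu%:R ^+ n * n%:R ^+ L) : R)
            @ \oo --> (ratr q : R),
        (fun n : nat => (mdim (G n))%:R / n%:R : R) @ \oo --> (A%:R : R)
      & (fun n : nat => ((mdegree (G n))%:~R : R) `^ (n%:R^-1))
            @ \oo --> (Mu%:R : R)].
Proof.
have [s [dimG low [_ ev]]] := hilbert_linear_growth_gen G hfg.
case: ev => [[n0 X0]|[A [B [e [n0 [Ac ee eP]]]]]].
  have [n1 nz] := hM; have [v /eqP[]] := nz _ (leq_maxr n0 n1).
  apply: (has_Kdim0_eq0 (H := G _)) => j.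
  have := dimG (maxn n0 n1) j; suff -> : hilbert_fun (G (maxn n0 n1)) j = 0%N by [].
  have [lt|ge] := ltP j (- s%:Z); first exact: low.
  rewrite -(X0 (maxn n0 n1) (leq_maxl _ _) (absz (j + s%:Z))); congr (hilbert_fun _ _); lia.
have inv n : (n0 <= n)%N ->
    (mdim (G n))%:Z = A%:Z * n%:Z + B /\ mdegree (G n) = e n.
  move=> /eP[e0 [D <- form]]; have e_n0 : e n != 0 by rewrite gt_eqF.
  by rewrite (mdimE (low n) e_n0 form) (mdegreeE (low n) e_n0 form).
have e_gt0 n : (n0 <= n)%N -> 0 < e n by case/eP.
have [Mu [L [q [Mu0 q0 lim]]]] := ev_expoly_limit R ee e_gt0.
have lim_deg : (fun n : nat => (mdegree (G n))%:~R / (Mu%:R ^+ n * n%:R ^+ L) : R)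
    @ \oo --> (ratr q : R).
  by move: lim; apply: (@cvg_eventually _ _ _ _ n0) => n le; rewrite (inv n le).2.
exists A, B, Mu, L; split=> //.
- by exists n0 => n le; case: (inv n le).
- by exists q.
- by apply: (@cvg_lin _ _ A B n0) => n le; case: (inv n le).
apply: (@root_limit _ _ Mu L (ratr q) n0) => //; first by rewrite ltr0q.
by move=> n le; rewrite (inv n le).2 ltr0z e_gt0.
Qed.
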